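(* Let $\mathbb{F}$ be a field of characteristic zero. Assume there is a $p$-family $(f_n)_{n\in\mathbb{N}}\in\mathsf{VP}$ such that $f_n$ requires branching programs of size $n^{\omega(1)}$. Let $(\Phi_n)_{n\in\mathbb{N}}$ be a sequence of arithmetic circuits of fan-in two and size $s(n)\le n^{O(1)}$ such that $\Phi_n$ computes $f_n$. Let $(\vec\alpha^{(n)})_n$ be points in $\mathbb{F}^n$ and $(\beta_n)_n$ field elements with $f_n(\vec\alpha^{(n)})\ne\beta_n$ for all $n$. Let $\mathcal{G}_n:\mathbb{F}^{n+s(n)}\to\mathbb{F}^{n+s(n)+1}$ be the local encoding of $\Phi_n(\vec\alpha^{(n)})=\beta_n$, write $\mathcal{G}_n=(g_{n,1},\ldots,g_{n,n+s(n)+1})$, and let $\mathcal{F}_n$ be the system $\{g_{n,1}=0,\ldots,g_{n,n+s(n)+1}=0\}$. Then $\mathcal{F}=(\mathcal{F}_n)_{n\in\mathbb{N}}$ is a sequence of unsatisfiable $\mathsf{VNC}^0$-equations that can be refuted by Geometric $\mathsf{VP}$-IPS, but cannot be refuted by Geometric $\mathsf{VBP}$-IPS.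
   Context: An arithmetic circuit has input gates labeled by variables or field constants and internal gates labeled $+$ or $\times$; size is the number of internal gates. An arithmetic branching program is a layered DAG with single source and sink, edges labeled by affine linear polynomials, computing the sum over source-to-sink paths of products of edge labels; size is number of vertices. ($f_n$ is taken to be $n$-variate.) Local encoding: for an $n$-variate arithmetic circuit $\Phi$ of fan-in two and size $s$, $\vec\alpha\in\mathbb{F}^n$, $\beta\in\mathbb{F}$, the local encoding of $\Phi(\vec\alpha)=\beta$ is the polynomial map $\mathbb{F}^{n+s}\to\mathbb{F}^{n+s+1}$ in variables $x_1,\ldots,x_n,y_1,\ldots,y_s$ with outputs, in order: (i) $x_1-\alpha_1,\ldots,x_n-\alpha_n$; (ii) for a fixed topological ordering $v_1,\ldots,v_s$ of the internal gates with $v_s$ the output gate, and $L(v)=\gamma$ for an input gate labeled by constant $\gamma$, $L(v)=x_i$ for an input gate labeled $x_i$, $L(v)=y_i$ if $v=v_i$: the $i$-th output is $L(v_i)-(L(u)+L(w))$ if $v_i$ is an addition gate with children $u,w$ and $L(v_i)-L(u)L(w)$ if a multiplication gate; (iii) $y_s-\beta$. A $p$-family is a sequence of polynomials with polynomially bounded degree; $\mathsf{VP}$ (resp. $\mathsf{VBP}$, $\mathsf{VNC}^0$) is the class of $p$-families computable by circuits of size $n^{O(1)}$ (resp. branching programs of size $n^{O(1)}$; circuits of size $O(1)$). A family of systems $\mathcal{F}_n=\{h_{n,1}=0,\ldots,h_{n,m(n)}=0\}$ is a family of $\mathscr{D}$-equations if every $p$-family $(h_{n,i_n})_n$ lies in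 $\mathscr{D}$. A Geometric IPS refutation of $(h_1,\ldots,h_m)$ (a system with no common zero over $\overline{\mathbb{F}}$) is a polynomial $r\in\mathbb{F}[z_1,\ldots,z_m]$ with $r(h_1,\ldots,h_m)=0$ and $r(0,\ldots,0)=1$. The family $\mathcal{F}$ can be refuted by Geometric $\mathscr{C}$-IPS if there is a $p$-family $(r_n)\in\mathscr{C}$ with $r_n$ a Geometric IPS refutation of $\mathcal{F}_n$.
   Formalization: That F can be refuted by Geometric VP-IPS is claimed only when the formal degree of Φ_n (input gates and constants counting 1) is polynomially bounded; otherwise cancelling copies of x_1^(2^n) in Φ_n force every refutation to have exponential degree. *)

(* Defs.v *)
From HB Require Import structures.
From mathcomp Require Import all_boot all_order all_algebra.
From mathcomp Require Import mpoly.

Set Implicit Arguments.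
Unset Strict Implicit.
Unset Printing Implicit Defensive.

Import GRing.Theory.
Local Open Scope ring_scope.

(* ------------------------------------------------------------------------ *)
(* Asymptotics                                                              *)

(* t(n) = n^O(1).  The additive c absorbs finitely many exceptions and makes
   the bound meaningful at n = 0 and n = 1. *)
Definition poly_bounded (t : nat -> nat) : Prop :=
  exists c : nat, forall n, (t n <= n ^ c + c)%N.

Definition bounded (t : nat -> nat) : Prop :=
  exists c : nat, forall n, (t n <= c)%N.

(* ------------------------------------------------------------------------ *)
(* Arithmetic circuits of fan-in two                                        *)

Inductive gate_op := Add | Mul.

Inductive node (F : Type) (n s : nat) :=
  | InVar of 'I_n
  | InConst of F
  | Gate of 'I_s.
Arguments InVar {F n s}.
Arguments InConst {F n s}.
Arguments Gate {F n s}.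

(* A circuit in n variables with s internal gates v_1, ..., v_s, listed in a
   topological order whose last element is the output gate (a circuit without
   internal gates consists of its output, an input gate).  Input gates are not
   counted in the size, so they are represented by their labels. *)
Record circuit (F : Type) (n s : nat) := Circuit {
  gop : 'I_s -> gate_op;
  gleft : 'I_s -> node F n s;
  gright : 'I_s -> node F n s;
  output : node F n s;
  gleft_lt : forall i j, gleft i = Gate j -> (j < i)%N;
  gright_lt : forall i j, gright i = Gate j -> (j < i)%N;
  output_last : if output is Gate j then j.+1 = s else s = 0%N
}.

Definition node_eval (F T : Type) (n s : nat) (var : 'I_n -> T)
    (const : F -> T) (gval : 'I_s -> T) (u : node F n s) : T :=
  match u with
  | InVar i => var i
  | InConst c => const c
  | Gate j => gval j
  end.

(* Evaluation in an arbitrary carrier T.  The counter k is fuel: gate i only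
   depends on gates of smaller index, so any k > i gives its value and the
   default dflt is never reached from circuit_eval. *)
Fixpoint gate_eval (F T : Type) (n s : nat) (dflt : T) (var : 'I_n -> T)
    (const : F -> T) (op : gate_op -> T -> T -> T) (C : circuit F n s)
    (k : nat) (i : 'I_s) : T :=
  if k is k'.+1 then
    let L := node_eval var const (gate_eval dflt var const op C k') in
    op (gop C i) (L (gleft C i)) (L (gright C i))
  else dflt.

Definition circuit_eval (F T : Type) (n s : nat) (dflt : T) (var : 'I_n -> T)
    (const : F -> T) (op : gate_op -> T -> T -> T) (C : circuit F n s) : T :=
  node_eval var const (gate_eval dflt var const op C s) (output C).

Definition ring_op (R : nzRingType) (o : gate_op) (a b : R) : R :=
  match o with Add => a + b | Mul => a * b end.

Definition circuit_poly (F : fieldType) (n s : nat) (C : circuit F n s) :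
    {mpoly F[n]} :=
  circuit_eval 0 (fun i => 'X_i) (fun c => c%:MP)
    (@ring_op {mpoly F[n]}) C.

(* Formal (syntactic) degree: every input gate, constants included, has
   degree 1; degrees are maximised at + gates and added at * gates.  It bounds
   the degree of the output after a fresh variable is added to every gate,
   which the degree of the computed polynomial does not, because of
   cancellations. *)
Definition formal_degree (F : Type) (n s : nat) (C : circuit F n s) : nat :=
  circuit_eval 0%N (fun _ => 1%N) (fun _ => 1%N)
    (fun o a b => match o with Add => maxn a b | Mul => (a + b)%N end) C.

(* ------------------------------------------------------------------------ *)
(* Algebraic branching programs                                             *)

Record abp (F : fieldType) (n w : nat) := ABP {
  layer : 'I_w -> nat;
  edge : rel 'I_w;
  label : 'I_w -> 'I_w -> {mpoly F[n]};
  source : 'I_w;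
  sink : 'I_w;
  edge_layer : forall u v, edge u v -> layer v = (layer u).+1;
  source_unique : forall v, (forall u, ~~ edge u v) <-> v = source;
  sink_unique : forall u, (forall v, ~~ edge u v) <-> u = sink;
  (* msize p is 1 + the total degree of p, and 0 for p = 0 *)
  label_affine : forall u v, edge u v -> (msize (label u v) <= 2)%N
}.

(* A path with l edges is the source followed by the l-tuple p; since the
   layer increases along edges, no path has w or more edges. *)
Definition abp_poly (F : fieldType) (n w : nat) (B : abp F n w) :
    {mpoly F[n]} :=
  \sum_(l < w)
    \sum_(p : l.-tuple 'I_w |
            path (edge B) (source B) p && (last (source B) p == sink B))
      \prod_(q <- pairmap (label B) (source B) p) q.

(* ------------------------------------------------------------------------ *)
(* p-families and complexity classes                                        *)

(* A sequence whose n-th member is a polynomial in k n variables. *)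
Definition mpoly_seq (F : fieldType) (k : nat -> nat) : Type :=
  forall n, {mpoly F[k n]}.

Definition poly_class (F : fieldType) : Type :=
  forall k : nat -> nat, mpoly_seq F k -> Prop.

Definition p_family (F : fieldType) (k : nat -> nat) (f : mpoly_seq F k) :
    Prop :=
  poly_bounded (fun n => (msize (f n)).-1).

Definition VP (F : fieldType) : poly_class F := fun k f =>
  p_family f /\
  exists (s : nat -> nat) (C : forall n, circuit F (k n) (s n)),
    poly_bounded s /\ forall n, circuit_poly (C n) = f n.

Definition VNC0 (F : fieldType) : poly_class F := fun k f =>
  p_family f /\
  exists (s : nat -> nat) (C : forall n, circuit F (k n) (s n)),
    bounded s /\ forall n, circuit_poly (C n) = f n.

Definition VBP (F : fieldType) : poly_class F := fun k f =>
  p_family f /\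
  exists (w : nat -> nat) (B : forall n, abp F (k n) (w n)),
    poly_bounded w /\ forall n, abp_poly (B n) = f n.

(* Every sequence of branching programs for f has size n^omega(1). *)
Definition requires_superpoly_abp (F : fieldType) (k : nat -> nat)
    (f : mpoly_seq F k) : Prop :=
  forall c : nat, exists N : nat, forall n, (N <= n)%N ->
    forall (w : nat) (B : abp F (k n) w), abp_poly B = f n -> (n ^ c <= w)%N.

(* ------------------------------------------------------------------------ *)
(* Systems of equations and Geometric IPS                                   *)

(* No common zero over the algebraic closure: K ranges over the algebraically
   closed algebraic extensions of F. *)
Definition unsatisfiable (F : fieldType) (n m : nat)
    (h : m.-tuple {mpoly F[n]}) : Prop :=
  forall (K : closedFieldType) (iota : {rmorphism F -> K}),
    (forall x : K, algebraicOver iota x) ->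
    ~ exists a : 'I_n -> K, forall j : 'I_m, mmap iota a (tnth h j) = 0.

Definition system_seq (F : fieldType) (k m : nat -> nat) : Type :=
  forall n, (m n).-tuple {mpoly F[k n]}.

Definition family_of_equations (F : fieldType) (D : poly_class F)
    (k m : nat -> nat) (h : system_seq F k m) : Prop :=
  forall i : (forall n, 'I_(m n)),
    p_family (fun n => tnth (h n) (i n)) ->
    D k (fun n => tnth (h n) (i n)).

Definition geometric_IPS_refutation (F : fieldType) (n m : nat)
    (h : m.-tuple {mpoly F[n]}) (r : {mpoly F[m]}) : Prop :=
  r \mPo h = 0 /\ r.@[fun _ => 0] = 1.

Definition refuted_by_geometric_IPS (F : fieldType) (D : poly_class F)
    (k m : nat -> nat) (h : system_seq F k m) : Prop :=
  exists r : mpoly_seq F m,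
    D m r /\ forall n, geometric_IPS_refutation (h n) (r n).

(* ------------------------------------------------------------------------ *)
(* Local encoding of C(alpha) = beta                                        *)

(* The variables x_i and y_i are 'X_(lshift s i) and 'X_(rshift n i). *)
Definition encoding_L (F : fieldType) (n s : nat) (u : node F n s) :
    {mpoly F[n + s]} :=
  node_eval (fun i : 'I_n => 'X_(lshift s i)) (fun c => c%:MP)
    (fun j : 'I_s => 'X_(rshift n j)) u.

(* The last output is y_s - beta, as L(output) = y_s when s > 0. *)
Definition local_encoding (F : fieldType) (n s : nat) (C : circuit F n s)
    (alpha : 'I_n -> F) (beta : F) : (n + s + 1).-tuple {mpoly F[n + s]} :=
  cat_tuple
    (cat_tuple
      [tuple 'X_(lshift s i) - (alpha i)%:MP | i < n]
      [tuple 'X_(rshift n i) -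
             ring_op (gop C i) (encoding_L (gleft C i))
                               (encoding_L (gright C i)) | i < s])
    [tuple encoding_L (output C) - beta%:MP].

(* Main.v *)
Require Import Defs.
From HB Require Import structures.
From mathcomp Require Import all_boot all_order all_algebra.
From mathcomp Require Import mpoly.
From mathcomp Require Import zify ring.
From Stdlib Require ClassicalEpsilon.

(* A refutation is a polynomial r(z) with one variable z_i for each equation. The
   first n + s equations of the local encoding are triangular, so they can be
   solved for the variables, which gives an explicit refutation of size O(n + s):
   z_out + beta - Phi~(z), where Phi~ evaluates the circuit after the gate
   variables z have been added to its gates, divided by its value at z = 0.

   Conversely, let r be any refutation given by a small branching program. The
   substitution z_i := x_i - alpha_i, z_gate := 0, z_out := t turns r into a
   nonzero P(x, t) of which t = g := f - beta is a root, say of multiplicity e.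
   Choose x0 where P / (t - g)^e does not vanish on the root, put t0 := g(x0) and
   substitute x := x0 + u^2 (x - x0), t := t0 + u v. Up to a factor c u^e, P becomes
   A = (v - y)^e k with y = (g(x0 + u^2 (x - x0)) - t0) / u divisible by u and k = 1
   modulo u. Hence A'/A has residue e y in v, and as A = v^e modulo u, the geometric
   series of 1 / A gives this residue, modulo a power of u, as a coefficient of
   A' * sum_i v^(e (M - i)) (v^e - A)^i. Coefficients in u and v are linear
   combinations of values at integers (characteristic zero), so g has a
   branching program of polynomial size, which contradicts the hardness of f. *)

Set Implicit Arguments.
Unset Strict Implicit.
Unset Printing Implicit Defensive.

Import GRing.Theory.
Local Open Scope ring_scope.

(** * Branching programs as inverses of unipotent matrices *)

Definition affine_mx (R : nzRingType) (n m k : nat) (A : 'M[{mpoly R[n]}]_(m, k)) :=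
  forall i j, (msize (A i j) <= 2)%N.

(** A topological order given as a rank function: it survives block constructions and substitutions,
    and the bound [w] on the ranks forces [N ^+ w = 0]. *)
Definition strictly_ranked (R : nzRingType) (w : nat) (rk : 'I_w -> nat)
    (N : 'M[R]_w) :=
  (forall i, rk i < w)%N /\ forall i j, N i j != 0 -> (rk i < rk j)%N.

(** The shift by [w1] places the second graph after the first, so any block of edges from the first
    to the second respects the ranks. *)
Definition block_rank (w1 w2 : nat) (rk1 : 'I_w1 -> nat) (rk2 : 'I_w2 -> nat)
    (i : 'I_(w1 + w2)) : nat :=
  match split i with inl j => rk1 j | inr j => (w1 + rk2 j)%N end.

(* [p = a (1 - N)^-1 b], the weighted count of the paths of an acyclic, not
   necessarily layered, graph on at most [w] vertices with adjacency matrix [N];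
   block matrices make this closed under sums and products. *)
Definition bp_computable (F : fieldType) (n w : nat) (p : {mpoly F[n]}) : Prop :=
  exists (w' : nat) (rk : 'I_w' -> nat) (N M : 'M[{mpoly F[n]}]_w')
         (a : 'rV[F]_w') (b : 'cV[F]_w'),
    [/\ (w' <= w)%N, affine_mx N, strictly_ranked rk N,
        M *m (1%:M - N) = 1%:M
      & p%:M = map_mx (@mpolyC n F) a *m M *m map_mx (@mpolyC n F) b :> 'M_1].

Section BranchingPrograms.
Variables (F : fieldType) (n : nat).
Implicit Types p q : {mpoly F[n]}.

Lemma bp_computableW w w' p : (w <= w')%N -> bp_computable w p -> bp_computable w' p.
Proof.
move=> le_ww' [v [rk [N [M [a [b [le_v aff rkN MN pE]]]]]]].
by exists v, rk, N, M, a, b; split=> //; apply: leq_trans le_v le_ww'.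
Qed.

Lemma bp_computableC c : bp_computable 1 (c%:MP : {mpoly F[n]}).
Proof.
exists 1%N, (fun=> 0%N), 0, 1%:M, c%:M, 1%:M; split=> //.
- by move=> i j; rewrite mxE msize0.
- by split=> // i j; rewrite mxE eqxx.
- by rewrite mul1mx subr0.
- by rewrite mulmx1 !map_scalar_mx /= rmorph1 mulmx1.
Qed.

Lemma bp_computableZ w c p : bp_computable w p -> bp_computable w (c *: p).
Proof.
move=> [v [rk [N [M [a [b [le_v aff rkN MN pE]]]]]]].
exists v, rk, N, M, (c *: a), b; split; [exact: le_v | exact: aff | exact: rkN | exact: MN | ].
rewrite map_mxZ -!scalemxAl -pE scale_scalar_mx; congr (_%:M).
by rewrite mul_mpolyC.
Qed.

Lemma affine_block w1 w2 (N1 : 'M[{mpoly F[n]}]_w1) (N2 : 'M_w2) E :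
  affine_mx N1 -> affine_mx N2 -> affine_mx E ->
  affine_mx (block_mx N1 E 0 N2).
Proof.
move=> aff1 aff2 affE i j; case: (split_ordP i) => k ->; case: (split_ordP j) => l ->;
by rewrite ?(block_mxEul, block_mxEur, block_mxEdl, block_mxEdr) // mxE msize0.
Qed.

Lemma strictly_ranked_block w1 w2 (rk1 : 'I_w1 -> nat) (rk2 : 'I_w2 -> nat)
    (N1 : 'M[{mpoly F[n]}]_w1) (N2 : 'M_w2) E :
  strictly_ranked rk1 N1 -> strictly_ranked rk2 N2 ->
  strictly_ranked (block_rank rk1 rk2) (block_mx N1 E 0 N2).
Proof.
move=> [lt1 rkN1] [lt2 rkN2]; split=> [i|i j].
  by rewrite /block_rank; case: splitP => j _; [rewrite ltn_addr | rewrite ltn_add2l].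
rewrite /block_rank; case: (split_ordP i) => k ->; case: (split_ordP j) => l ->;
  rewrite ?(block_mxEul, block_mxEur, block_mxEdl, block_mxEdr) /=.
- exact: rkN1.
- by rewrite ltn_addr.
- by rewrite mxE eqxx.
- by rewrite ltn_add2l; apply: rkN2.
Qed.

Lemma block_inverse w1 w2 (N1 M1 : 'M[{mpoly F[n]}]_w1) (N2 M2 : 'M_w2) E :
  M1 *m (1%:M - N1) = 1%:M -> M2 *m (1%:M - N2) = 1%:M ->
  block_mx M1 (M1 *m E *m M2) 0 M2 *m (1%:M - block_mx N1 E 0 N2) = 1%:M.
Proof.
move=> MN1 MN2.
rewrite scalar_mx_block opp_block_mx add_block_mx oppr0 add0r addr0 mulmx_block.
rewrite -!mulmxA MN1 MN2 !mul0mx !mulmx0 !addr0 !add0r mulmx1 mulmxN addNr.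
by rewrite -scalar_mx_block.
Qed.

Lemma bp_computableD w1 w2 p q :
  bp_computable w1 p -> bp_computable w2 q -> bp_computable (w1 + w2) (p + q).
Proof.
move=> [v1 [rk1 [N1 [M1 [a1 [b1 [le_v1 aff1 rkN1 MN1 pE]]]]]]].
move=> [v2 [rk2 [N2 [M2 [a2 [b2 [le_v2 aff2 rkN2 MN2 qE]]]]]]].
exists (v1 + v2)%N, (block_rank rk1 rk2), (block_mx N1 0 0 N2), (block_mx M1 (M1 *m 0 *m M2) 0 M2).
exists (row_mx a1 a2), (col_mx b1 b2).
split; first exact: leq_add.
- by apply: affine_block => // i j; rewrite mxE msize0.
- exact: strictly_ranked_block rkN1 rkN2.
- exact: block_inverse.
rewrite map_row_mx map_col_mx mul_row_block mul_row_col.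
by rewrite !mulmx0 mul0mx mulmx0 addr0 add0r -pE -qE raddfD.
Qed.

Lemma bp_computableM w1 w2 p q :
  bp_computable w1 p -> bp_computable w2 q -> bp_computable (w1 + w2) (p * q).
Proof.
move=> [v1 [rk1 [N1 [M1 [a1 [b1 [le_v1 aff1 rkN1 MN1 pE]]]]]]].
move=> [v2 [rk2 [N2 [M2 [a2 [b2 [le_v2 aff2 rkN2 MN2 qE]]]]]]].
(* [E] joins the ends of the first graph to the starts of the second, which yields
   [a1 M1 b1 a2 M2 b2]. Its entries are constants, hence affine, because [b1] and [a2] have entries
   in [F]. *)
pose E := map_mx (@mpolyC n F) (b1 *m a2).
exists (v1 + v2)%N, (block_rank rk1 rk2), (block_mx N1 E 0 N2), (block_mx M1 (M1 *m E *m M2) 0 M2).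
exists (row_mx a1 0), (col_mx 0 b2).
split; first exact: leq_add.
- by apply: affine_block => // i j; rewrite mxE msizeC; case: eqP.
- exact: strictly_ranked_block rkN1 rkN2.
- exact: block_inverse.
rewrite map_row_mx map_col_mx mul_row_block mul_row_col !map_mx0.
rewrite !mulmx0 !mul0mx add0r addr0 /E map_mxM scalar_mxM qE pE.
rewrite !mulmxA; reflexivity.
Qed.

Lemma bp_computable0 : bp_computable 0 (0 : {mpoly F[n]}).
Proof.
exists 0%N, (fun=> 0%N), 0, 0, 0, 0; split=> //; try by move=> [].
- by split=> [[]|[]].
- by apply/matrixP=> [[]].
- by rewrite !map_mx0 !mul0mx raddf0.
Qed.

Lemma bp_computable_sum (I : Type) (r : seq I) (P : pred I) (w : I -> nat)
    (p : I -> {mpoly F[n]}) :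
  (forall i, P i -> bp_computable (w i) (p i)) ->
  bp_computable (\sum_(i <- r | P i) w i) (\sum_(i <- r | P i) p i).
Proof.
move=> wp; elim/big_rec2: _ => [|i v q Pi vq].
  exact: bp_computable0.
by apply: bp_computableD => //; apply: wp.
Qed.

Lemma bp_computableX w p k : bp_computable w p -> bp_computable (k * w + 1) (p ^+ k).
Proof.
move=> wp; elim: k => [|k IHk]; first by rewrite expr0 -mpolyC1; apply: bp_computableC.
by rewrite exprS mulSn -addnA; apply: bp_computableM.
Qed.

End BranchingPrograms.

Lemma msize_comp_affine (F : fieldType) (n m : nat) (l : n.-tuple {mpoly F[m]})
    (p : {mpoly F[n]}) :
  (forall i, msize (tnth l i) <= 2)%N -> (msize p <= 2)%N -> (msize (p \mPo l) <= 2)%N.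
Proof.
move=> affl affp; rewrite comp_mpolyE.
apply: leq_trans (msize_sum _ _ _) _; apply/bigmax_leqP_seq => /= k kp _.
apply: leq_trans (msizeZ_le _ _) _.
have : (mdeg k <= 1)%N by have := msize_mdeg_lt kp; lia.
case: (posnP (mdeg k)) => [/eqP|k0 k1].
  rewrite mdeg_eq0 => /eqP -> _; rewrite big1 ?msize1 // => i _.
  by rewrite mnm0E expr0.
have /eqP : (mdeg k == 1)%N by lia.
move/eqP/mdeg1P => [i /eqP ->].
rewrite (bigD1 i) //= big1 ?mulr1 => [|j ji].
  by rewrite mnm1E eqxx expr1.
by rewrite mnm1E eq_sym (negbTE ji) expr0.
Qed.

(** Substitution is a ring morphism, so applied entrywise it carries the inverse of [1 - N] along,
    and affine forms keep [N] affine: the size does not grow. *)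
Lemma bp_computable_comp (F : fieldType) (n m w : nat)
    (l : n.-tuple {mpoly F[m]}) (p : {mpoly F[n]}) :
  (forall i, msize (tnth l i) <= 2)%N ->
  bp_computable w p -> bp_computable w (p \mPo l).
Proof.
move=> affl [v [rk [N [M [a [b [le_v aff rkN MN pE]]]]]]].
exists v, rk, (map_mx (comp_mpoly l) N), (map_mx (comp_mpoly l) M), a, b.
split=> //.
- by move=> i j; rewrite mxE; apply: msize_comp_affine.
- case: rkN => lt_rk rkN; split=> // i j; rewrite mxE => nz; apply: rkN.
  by apply: contraNneq nz => ->; rewrite comp_mpoly0.
- have := congr1 (map_mx (comp_mpoly l)) MN.
  by rewrite map_mxM map_mxB map_scalar_mx /= comp_mpoly1.
have := congr1 (map_mx (comp_mpoly l)) pE.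
have mapC k k' (A : 'M[F]_(k, k')) :
    map_mx (comp_mpoly l) (map_mx (@mpolyC n F) A) = map_mx (@mpolyC m F) A.
  by apply/matrixP => i j; rewrite !mxE comp_mpolyC.
by rewrite map_scalar_mx !map_mxM !mapC.
Qed.

(** * Path sums and powers of the adjacency matrix *)

Section Adjacency.
Variables (F : fieldType) (n : nat).
Local Notation R := {mpoly F[n]}.

Lemma sum_path_mx (w : nat) (e : rel 'I_w) (lab : 'I_w -> 'I_w -> R) l u v :
  \sum_(p : l.-tuple 'I_w | path e u p && (last u p == v))
     \prod_(q <- pairmap lab u p) q =
  ((\matrix_(i, j) if e i j then lab i j else 0) ^+ l) u v.
Proof.
set N := \matrix_(_, _) _.
elim: l u => [|l IHl] u.
  rewrite expr0 mxE (eq_bigl (fun=> u == v)) => [|p]; last by rewrite tuple0.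
  case: eqVneq => _; last by rewrite big_pred0.
  by rewrite (big_pred1 [tuple]) ?big_nil // => p /=; rewrite tuple0; apply/esym/eqP.
rewrite exprS mxE.
(* Splitting off the first vertex after [u] matches the expansion of [N ^+ l.+1] as [N * N ^+ l]. *)
pose cns (xp : 'I_w * l.-tuple 'I_w) := [tuple of xp.1 :: xp.2].
rewrite (reindex cns) /=; last first.
  exists (fun p => (thead p, [tuple of behead p])) => [[x p]|p] _.
    by congr pair; apply/val_inj.
  by rewrite /cns /= -tuple_eta.
under eq_bigl do rewrite -andbA.
under eq_bigr do rewrite big_cons.
rewrite -(pair_big_dep (e u) (fun x (p : l.-tuple 'I_w) => path e x p && (last x p == v))
   (fun x (p : l.-tuple 'I_w) => lab u x * \prod_(q <- pairmap lab x p) q)) big_mkcond.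
apply: eq_bigr => x _; rewrite mxE; case: ifP => _; last by rewrite mul0r.
by rewrite -big_distrr IHl.
Qed.

(** A nonzero entry of [N ^+ l] raises the rank by at least [l], and ranks stay below [w]. *)
Lemma strictly_ranked_nilp (w : nat) (rk : 'I_w -> nat) (N : 'M[R]_w) :
  strictly_ranked rk N -> N ^+ w = 0.
Proof.
move=> [lt_rk rkN].
have rkX l i j : (N ^+ l) i j != 0 -> (rk i + l <= rk j)%N.
  elim: l i => [|l IHl] i.
    by rewrite expr0 mxE; case: (eqVneq i j) => [->|]; rewrite ?addn0 ?eqxx.
  rewrite exprS mxE => nz.
  have [k nzk] : exists k, N i k * (N ^+ l) k j != 0.
    apply/existsP; apply: contraNT nz; rewrite negb_exists => /forallP z.
    by rewrite big1 // => k _; apply/eqP; rewrite -[_ == _]negbK z.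
  have /rkN ik : N i k != 0 by apply: contraNneq nzk => ->; rewrite mul0r.
  have /IHl kj : (N ^+ l) k j != 0 by apply: contraNneq nzk => ->; rewrite mulr0.
  by lia.
apply/matrixP => i j; rewrite [RHS]mxE; apply/eqP; case: eqP => // /eqP /rkX.
by have := lt_rk j; lia.
Qed.

Lemma mulmx_geometric (w : nat) (N : 'M[R]_w) m :
  (\sum_(l < m) N ^+ l) *m (1%:M - N) = 1%:M - N ^+ m.
Proof.
elim: m => [|m IHm]; first by rewrite big_ord0 mul0mx expr0 subrr.
by rewrite big_ord_recr mulmxDl IHm mulmxBr mulmx1 /= mulmxE -exprSr addrA subrK.
Qed.

Lemma bp_computable_abp w (B : abp F n w) : bp_computable w (abp_poly B).
Proof.
pose N : 'M[R]_w := \matrix_(i, j) if edge B i j then label B i j else 0.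
(* Layers may be numbered beyond [w]; counting the vertices in lower layers gives a rank below [w]
   that still increases along edges. *)
pose rk (i : 'I_w) := #|[set j | (layer B j < layer B i)%N]|.
have rkN : strictly_ranked rk N.
  split=> [i|i j].
    rewrite -[X in (_ < X)%N]card_ord -cardsT; apply: proper_card.
    by rewrite properT; apply/eqP => /setP/(_ i); rewrite !inE ltnn.
  rewrite mxE; case: ifP => [/edge_layer eij _|_]; last by rewrite eqxx.
  apply: proper_card; apply/properP; split.
    by apply/subsetP => k; rewrite !inE eij; lia.
  by exists i; rewrite !inE ?eij ?ltnn.
exists w, rk, N, (\sum_(l < w) N ^+ l), (delta_mx 0 (source B)), (delta_mx (sink B) 0).
split; first exact: leqnn; last 2 first.
- by rewrite mulmx_geometric (strictly_ranked_nilp rkN) subr0.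
- rewrite !map_delta_mx -rowE -colE; apply/matrixP => i j; rewrite !ord1 !mxE mulr1n.
  by rewrite summxE; apply: eq_bigr => l _; rewrite sum_path_mx.
- by move=> i j; rewrite mxE; case: ifP => [/label_affine|]; rewrite ?msize0.
- exact: rkN.
Qed.

Section FinTypeAbp.
Variables (V : finType) (lay : V -> nat) (e : rel V) (lab : V -> V -> R) (s t : V).
Hypotheses (e_lay : forall u v, e u v -> lay v = (lay u).+1)
  (s_uniq : forall v, (forall u, ~~ e u v) <-> v = s)
  (t_uniq : forall u, (forall v, ~~ e u v) <-> u = t)
  (lab_aff : forall u v, e u v -> (msize (lab u v) <= 2)%N).

Fixpoint path_weight l v : R :=
  if l is l'.+1 then \sum_u path_weight l' u * (if e u v then lab u v else 0)
  else (v == s)%:R.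

(** Layers increase by one along edges, so a vertex is reached from [s] by paths of a single
    length. *)
Lemma path_weight_layer l v : path_weight l v != 0 -> lay v = (lay s + l)%N.
Proof.
elim: l v => [|l IHl] v /=.
  by case: (eqVneq v s) => [->|]; rewrite ?addn0 ?eqxx.
move=> nz; have [u nzu] : exists u, path_weight l u * (if e u v then lab u v else 0) != 0.
  apply/existsP; apply: contraNT nz; rewrite negb_exists => /forallP z.
  by rewrite big1 // => k _; apply/eqP; rewrite -[_ == _]negbK z.
have euv : e u v by apply: contraNT nzu => /negbTE ->; rewrite mulr0.
have /IHl : path_weight l u != 0 by apply: contraNneq nzu => ->; rewrite mul0r.
by rewrite (e_lay euv) addnS => ->.
Qed.

Lemma abp_of_finType :
  exists B : abp F n #|V|, abp_poly B = \sum_(l < #|V|) path_weight l t.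
Proof.
have su (v : 'I_#|V|) : (forall u : 'I_#|V|, ~~ e (enum_val u) (enum_val v)) <-> v = enum_rank s.
  split=> [nuv|-> u]; last first.
    by rewrite enum_rankK; move: (enum_val u); apply/s_uniq.
  have /s_uniq <- : forall u, ~~ e u (enum_val v); last by rewrite enum_valK.
  by move=> u; have := nuv (enum_rank u); rewrite enum_rankK.
have tu (u : 'I_#|V|) : (forall v : 'I_#|V|, ~~ e (enum_val u) (enum_val v)) <-> u = enum_rank t.
  split=> [nuv|-> v]; last first.
    by rewrite enum_rankK; move: (enum_val v); apply/t_uniq.
  have /t_uniq <- : forall v, ~~ e (enum_val u) v; last by rewrite enum_valK.
  by move=> v; have := nuv (enum_rank v); rewrite enum_rankK.
exists (@ABP F n #|V| (fun u : 'I_#|V| => lay (enum_val u)) (fun u v => e (enum_val u) (enum_val v))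
  (fun u v => lab (enum_val u) (enum_val v)) (enum_rank s) (enum_rank t)
  (fun u v => @e_lay _ _) su tu (fun u v => @lab_aff _ _)).
apply: eq_bigr => l _; rewrite sum_path_mx /=.
set N := \matrix_(_, _) _; elim: {l}(l : nat) t => [|l IHl] v /=.
  by rewrite expr0 mxE (inj_eq enum_rank_inj) eq_sym.
rewrite exprSr mxE (reindex enum_rank) /=; last exact/onW_bij/enum_rank_bij.
by apply: eq_bigr => u _; rewrite IHl mxE !enum_rankK.
Qed.

End FinTypeAbp.

End Adjacency.

Arguments path_weight : simpl never.

(** * Layered programs for iterated matrix products *)

Section LayeredAbp.
Variables (F : fieldType) (n W K : nat).
Local Notation R := {mpoly F[n]}.
Variables (a : 'rV[R]_W.+1) (A : 'M[R]_W.+1) (b : 'cV[R]_W.+1).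
Hypotheses (aff_a : affine_mx a) (aff_A : affine_mx A) (aff_b : affine_mx b).

(* [inl true] and [inl false] are the source and the sink, and [inr (l, j)] is
   the [j]-th vertex of layer [l.+1]. *)
Let V : finType := (bool + 'I_K.+1 * 'I_W.+1)%type.

Let lay (u : V) : nat :=
  match u with inl true => 0 | inl false => K.+2 | inr (l, _) => l.+1 end.

Let lab (u v : V) : R :=
  match u, v with
  | inl true, inr (_, j) => a 0 j
  | inr (_, i), inr (_, j) => A i j
  | inr (_, i), inl false => b i 0
  | _, _ => 0
  end.

(** Consecutive layers are joined completely, with labels that may be zero, so that no vertex other
    than the intended ones is a source or a sink. *)
Let e : rel V := fun u v => lay v == (lay u).+1.

Lemma layered_abp :
  exists (w : nat) (B : abp F n w),
    w = (K.+1 * W.+1 + 2)%N /\ abp_poly B = (a *m A ^+ K *m b) 0 0.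
Proof.
have cardV : #|V| = (K.+1 * W.+1 + 2)%N.
  by rewrite card_sum card_prod !card_ord card_bool addnC.
have e_lay u v : e u v -> lay v = (lay u).+1 by move/eqP.
have s_uniq v : (forall u, ~~ e u v) <-> v = inl true.
  split=> [|-> [[]|[l i]] //].
  case: v => [[]|[l j]] nuv; first by [].
    by have := nuv (inr (ord_max, ord0)); rewrite /e /= ?eqxx.
  have [l0|l0] := posnP l.
    by have := nuv (inl true); rewrite /e /= l0.
  have lt_l : (l.-1 < K.+1)%N by have := ltn_ord l; lia.
  by have := nuv (inr (Ordinal lt_l, ord0)); rewrite /e /= prednK // eqxx.
have t_uniq u : (forall v, ~~ e u v) <-> u = inl false.
  split=> [|-> [[]|[l i]]]; rewrite /e //=; last 2 first.
  - by rewrite eqn_leq ltnn andbF.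
  - by have := ltn_ord l; case: eqP => //; lia.
  case: u => [[]|[l j]] nuv; last 2 first.
  - exact: erefl.
  - have [lK|lK] := ltnP l K.
      have lt_l : (l.+1 < K.+1)%N by [].
      by have := nuv (inr (Ordinal lt_l, ord0)); rewrite /e /= ?eqxx.
    have lE : (l : nat) = K by have := ltn_ord l; lia.
    by have := nuv (inl false); rewrite /e /= lE eqxx.
  - by have := nuv (inr (ord0, ord0)); rewrite /e /= ?eqxx.
have lab_aff u v : e u v -> (msize (lab u v) <= 2)%N.
  by case: u v => [[]|[l i]] [[]|[k j]] //=; rewrite msize0.
have [B BE] := abp_of_finType e_lay s_uniq t_uniq lab_aff.
exists #|V|, B; split=> //; rewrite {}BE.
pose pw := path_weight e lab (inl true).
have pw0 v : pw 0 v = (v == inl true)%:R by [].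
have pwS l v : pw l.+1 v = \sum_u pw l u * (if e u v then lab u v else 0) by [].
(* The first edge contributes [a], so only [l] of the [l.+1] edges carry a factor [A]. *)
have pwE l (k : 'I_K.+1) j : (k : nat) = l -> pw l.+1 (inr (k, j)) = (a *m A ^+ l) 0 j.
  elim: l k j => [|l IHl] k j kl.
    rewrite pwS big_sumType big_bool /= !pw0 /e /= kl ?eqxx /=.
    rewrite mul1r mul0r addr0 big1 ?addr0; first by rewrite expr0 mulmx1.
    by move=> x _; rewrite pw0 mul0r.
  have lt_l : (l < K.+1)%N by have := ltn_ord k; lia.
  rewrite pwS big_sumType big_bool /e [LHS]/= kl.
  have -> : (l.+2 == K.+3) = false by apply/eqP; lia.
  rewrite !mulr0 !add0r.
  rewrite exprSr mulmxA mxE.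
  transitivity (\sum_(x : 'I_K.+1 * 'I_W.+1 | x.1 == Ordinal lt_l)
     (a *m A ^+ l) 0 x.2 * A x.2 j).
    rewrite [RHS]big_mkcond; apply: eq_bigr => -[k' i] _ /=.
    rewrite eqSS eqSS eq_sym -val_eqE /=; case: eqP => [kl'|]; last by rewrite mulr0.
    by rewrite -(IHl k').
  rewrite (eq_bigl (fun x => (x.1 == Ordinal lt_l) && true)); last by move=> x; rewrite andbT.
  rewrite -(pair_big (fun k => k == Ordinal lt_l) xpredT (fun _ i => (a *m A ^+ l) 0 i * A i j)).
  by rewrite big_pred1_eq.
have ltK : (K.+2 < #|V|)%N by rewrite cardV; nia.
(* Every path to the sink has [K.+2] edges, so one length survives in the sum. *)
rewrite (bigD1 (Ordinal ltK)) //= [X in _ + X]big1 ?addr0; last first.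
  move=> l; apply: contraNeq => /(path_weight_layer e_lay) /= lE.
  by rewrite -val_eqE /= lE.
transitivity (pw K.+2 (inl false)); first exact: erefl.
rewrite pwS big_sumType big_bool /e [LHS]/=.
have -> : (K.+2 == K.+3) = false by apply/eqP; lia.
rewrite !mulr0 !add0r mxE.
transitivity (\sum_(x : 'I_K.+1 * 'I_W.+1 | x.1 == ord_max)
     (a *m A ^+ K) 0 x.2 * b x.2 0).
  rewrite [RHS]big_mkcond; apply: eq_bigr => -[k' i] _ /=.
  rewrite eqSS eqSS eq_sym -val_eqE /=; case: eqP => [kl'|]; last by rewrite mulr0.
  by rewrite -(pwE _ k').
rewrite (eq_bigl (fun x => (x.1 == ord_max) && true)); last by move=> x; rewrite andbT.
rewrite -(pair_big (fun k => k == ord_max) xpredT (fun _ i => (a *m A ^+ K) 0 i * b i 0)).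
by rewrite big_pred1_eq.
Qed.

End LayeredAbp.

Section BpToAbp.
Variables (F : fieldType) (n : nat).
Local Notation R := {mpoly F[n]}.

(** Nilpotency makes the geometric series a right inverse of [1 - N], and the left inverse [M]
    agrees with it. *)
Lemma inverse_geometric w (N M : 'M[R]_w) rk :
  strictly_ranked rk N -> M *m (1%:M - N) = 1%:M -> M = \sum_(l < w) N ^+ l.
Proof.
move=> rkN MN.
have : (1%:M - N) *m (\sum_(l < w) N ^+ l) = 1%:M.
  transitivity ((\sum_(l < w) N ^+ l) *m (1%:M - N)); last first.
    by rewrite mulmx_geometric (strictly_ranked_nilp rkN) subr0.
  rewrite mulmx_sumr mulmx_suml; apply: eq_bigr => l _.
  by rewrite mulmxBr mulmxBl mulmx1 mul1mx mulmxE -exprS -exprSr.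
by move/(congr1 (mulmx M)); rewrite mulmxA MN mul1mx mulmx1.
Qed.

Lemma affine_map_mpolyC m k (A : 'M[F]_(m, k)) : affine_mx (map_mx (@mpolyC n F) A).
Proof. by move=> i j; rewrite mxE msizeC; case: eqP. Qed.

(* Horner's scheme: [N, b; 0, 1] ^ l maps (0, 1) to (\sum_(k < l) N ^ k b, 1). *)
Lemma block_geometric w (N : 'M[R]_w) (b : 'cV[R]_w) l :
  (block_mx N b 0 1%:M : 'M_(w + 1)) ^+ l *m col_mx 0 1%:M =
  col_mx (\sum_(k < l) N ^+ k *m b) 1%:M.
Proof.
elim: l => [|l IHl]; first by rewrite expr0 mul1mx big_ord0.
rewrite exprS -mulmxE -mulmxA IHl mul_block_col mul0mx mul1mx mulmx1 add0r.
congr col_mx; rewrite big_ord_recl expr0 mul1mx addrC mulmx_sumr; congr (_ + _).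
by apply: eq_bigr => k _; rewrite exprS mulmxA.
Qed.

(** Layering squares the size: the geometric series has [v] terms, so [v] steps of Horner's scheme
    suffice, giving [v + 1] layers of [v + 1] vertices besides source and sink. *)
Lemma abp_of_bp_computable w (p : R) :
  bp_computable w p ->
  exists (w' : nat) (B : abp F n w'),
    (w' <= w.+1 ^ 2 + 2)%N /\ abp_poly B = p.
Proof.
move=> [v [rk [N [M [a [b [le_v aff rkN MN pE]]]]]]].
pose A : 'M[R]_(v + 1) := block_mx N (map_mx (@mpolyC n F) b) 0 1%:M.
pose a' : 'rV[R]_(v + 1) := row_mx (map_mx (@mpolyC n F) a) 0.
pose b' : 'cV[R]_(v + 1) := col_mx 0 1%:M.
have aff_a : affine_mx a'.
  move=> i j; case: (split_ordP j) => k ->; rewrite ?row_mxEl ?row_mxEr.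
    exact: affine_map_mpolyC.
  by rewrite mxE msize0.
have aff_b : affine_mx b'.
  move=> i j; case: (split_ordP i) => k ->; rewrite ?col_mxEu ?col_mxEd mxE ?msize0 //.
  by rewrite !ord1 mulr1n msize1.
have aff_A : affine_mx A.
  apply: affine_block => //; last exact: affine_map_mpolyC.
  by move=> i j; rewrite mxE !ord1 mulr1n msize1.
have -> : p = (a' *m A ^+ v *m b') 0 0.
  rewrite -mulmxA block_geometric mul_row_col mul0mx addr0 -mulmx_suml mulmxA.
  by rewrite -(inverse_geometric rkN MN) -pE mxE mulr1n.
move: {MN pE} a' A b' aff_a aff_A aff_b; rewrite addn1 => a' A b' aff_a aff_A aff_b.
have [w' [B [w'E BE]]] := layered_abp v aff_a aff_A aff_b.
by exists w', B; split=> //; rewrite w'E; nia.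
Qed.

End BpToAbp.

(** * The residue of a logarithmic derivative *)

Section Residue.
Variables (R : idomainType).
Implicit Types p q : {poly {poly R}}.

(** The constant coefficient of [a] is nonzero, so comparing coefficients from the lowest on kills
    those of [t] below [N]. *)
Lemma polyX_cancel (K : idomainType) (a t z : {poly K}) N :
  a`_0 != 0 -> a * t = z * 'X^N -> exists t', t = t' * 'X^N.
Proof.
move=> a0 atE; suff t0 i : (i < N)%N -> t`_i = 0.
  exists (drop_poly N t); rewrite -[LHS](poly_take_drop N).
  suff -> : take_poly N t = 0 by rewrite add0r.
  by apply/polyP => i; rewrite coef_take_poly coef0; case: ifP => // /t0.
elim/ltn_ind: i => i IHi iN; apply: (mulfI a0); rewrite mulr0.
have := congr1 (coefp i) atE; rewrite /= coefMXn iN coefM big_ord_recl subn0.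
rewrite [X in _ + X]big1 ?addr0 // => j _; rewrite lift0.
by rewrite IHi ?mulr0 //; have := ltn_ord j; lia.
Qed.

Lemma map_deriv_M p q :
  map_poly (@deriv R) (p * q) = map_poly (@deriv R) p * q + p * map_poly (@deriv R) q.
Proof.
apply/polyP => i; rewrite coefD coef_map /= !coefM raddf_sum -big_split.
by apply: eq_bigr => j _; rewrite !coef_map /= derivM.
Qed.

Variables (y0 : {poly R}) (k : {poly {poly R}}) (e M : nat).
Hypotheses (e_gt0 : (0 < e)%N) (M_gt0 : (0 < M)%N) (k0 : k`_0 = 1).

Let y : {poly R} := y0 * 'X.
Let V : {poly {poly R}} := 'X%:P.
Let Y : {poly {poly R}} := map_poly polyC y.
Let A := (V - Y) ^+ e * k.
Let Z := V ^+ e - A.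
Let S := \sum_(i < M.+1) (V ^+ e) ^+ (M - i) * Z ^+ i.
Let L := (e * M.+1)%N.

(* In [{poly {poly R}}] the outer variable is [u] and the inner one is [v].
   [A'/A] has residue [e * y] at the [e]-fold root [v = y] of [A]; modulo
   [u ^ M.+1] the inverse of [A = v ^ e - Z] is [S / v ^ L], as [u] divides [Z]. *)
Lemma log_deriv_residue i : (i <= M)%N ->
  (map_poly (@deriv R) A * S)`_i`_(L - 2) = y`_i *+ e.
Proof.
move=> iM.
have YE : Y = map_poly polyC y0 * 'X by rewrite /Y rmorphM /= map_polyX.
have AS : A * S = V ^+ L - Z ^+ M.+1.
  rewrite /L exprM subrXX; congr (_ * _).
  by rewrite /Z opprB addrC subrK.
(* Modulo [u], [Y] vanishes and [k] is 1, so [u] divides [Z]. *)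
have [Z1 ZE] : exists Z1, Z = Z1 * 'X.
  have /factor_theorem [Z1] : root Z 0.
    rewrite /root /Z /A !(hornerE, horner_exp) YE hornerM hornerX mulr0 subr0.
    by rewrite horner_coef0 k0 mulr1 subrr.
  by rewrite subr0; exists Z1.
have [k1 kE] : exists k1, k = 1 - k1 * 'X.
  have /factor_theorem [k1 k1E] : root (1 - k) 0.
    by rewrite /root !hornerE horner_coef0 k0 subrr.
  by exists k1; rewrite -[X in k1 * X]subr0 -polyC0 -k1E opprB addrC subrK.
(* [kappa] inverts [k] modulo [u ^ M.+1]. *)
have [kappa kkE] : exists kappa, k * kappa = 1 - k1 ^+ M.+1 * 'X^(M.+1).
  exists (\sum_(j < M.+1) (k1 * 'X) ^+ j).
  by rewrite -exprMn -[RHS]opprB subrX1 -mulNr opprB -kE.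
(* The term of [A' * S] that contains the derivative of [k] is a multiple of [U]. Modulo [u ^ M.+1]
   it is divisible by [V ^+ L], so it does not reach the coefficient [L - 2]. *)
pose U := (V - Y) ^+ e * S.
have kU : k * U = V ^+ L - Z ^+ M.+1 by rewrite -AS /U mulrA [k * _]mulrC.
have [U1 UE] : exists U1, U = kappa * V ^+ L + U1 * 'X^(M.+1).
  exists (k1 ^+ M.+1 * U - kappa * Z1 ^+ M.+1).
  have -> : kappa * V ^+ L = kappa * (k * U + Z ^+ M.+1) by rewrite kU subrK.
  rewrite mulrDr mulrA [kappa * k]mulrC kkE ZE exprMn.
  by ring.
pose T := (V - Y) ^+ e.-1 * k * S.
have VYT : (V - Y) * T = V ^+ L - Z ^+ M.+1.
  by rewrite -AS /T !mulrA -exprS prednK.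
(* Multiplied by [V - Y], both [T] and [G] give [V ^+ L] modulo [u ^ M.+1]; for [G] the error is
   [Y ^+ L], and [L >= M.+1]. Cancelling [V - Y], whose constant term in [u] is [v], identifies
   them. *)
pose G := \sum_(j < L) V ^+ (L.-1 - j) * Y ^+ j.
have [T1 TE] : exists T1, T - G = T1 * 'X^(M.+1).
  have V0 : (V - Y)`_0 != 0.
    by rewrite coefB YE coefMX subr0 /V coefC eqxx polyX_eq0.
  apply: (polyX_cancel (z := map_poly polyC y0 ^+ L * 'X^(L - M.+1) - Z1 ^+ M.+1) V0).
  rewrite mulrBr VYT -subrXX ZE YE !exprMn mulrBl -mulrA -exprD subnK.
    by ring.
  by rewrite /L; nia.
have DVY m : map_poly (@deriv R) ((V - Y) ^+ m) = (V - Y) ^+ m.-1 *+ m.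
  have D1 : map_poly (@deriv R) (V - Y) = 1.
    rewrite raddfB /= map_polyC /= derivX -map_poly_comp.
    suff -> : map_poly (@deriv R \o polyC) y = 0 by rewrite subr0.
    by apply/polyP => j; rewrite coef_map_id0 /= ?derivC ?coef0.
  elim: m => [|m IHm]; first by rewrite expr0 map_polyC /= derivC polyC0.
  rewrite exprS map_deriv_M IHm D1 mul1r mulrS; case: m {IHm} => [|m].
    by rewrite !mulr0n mulr0.
  by rewrite mulrnAr -exprS.
have -> : map_poly (@deriv R) A * S =
    G *+ e + (map_poly (@deriv R) k * kappa) * V ^+ L
    + (T1 *+ e + map_poly (@deriv R) k * U1) * 'X^(M.+1).
  rewrite map_deriv_M DVY mulrDl.
  have -> : (V - Y) ^+ e.-1 *+ e * k * S = T *+ e by rewrite /T !mulrnAl.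
  have -> : (V - Y) ^+ e * map_poly (@deriv R) k * S = map_poly (@deriv R) k * U.
    by rewrite /U mulrCA mulrA.
  rewrite UE -[T](subrK G) TE addrC [_ + G]addrC mulrnDl mulrDr mulrDl !mulrA mulrnAl.
  by rewrite addrC addrACA.
rewrite coefD coefMXn ltnS iM addr0 coefD coefMn -rmorphXn coefMC.
rewrite coefD coefMXn ifT ?addr0; last by rewrite /L; nia.
rewrite coefMn; congr (_ *+ _).
(* Only the term [j = 1] of [G], namely [V ^+ (L - 2) * Y], has degree [L - 2] in [v]. *)
have L2 : (1 < L)%N by rewrite /L; nia.
rewrite /G coef_sum coef_sum (bigD1 (Ordinal L2)) //= big1 ?addr0 => [|j].
  rewrite expr1 -rmorphXn coefCM coef_map /= coefMC coefXn -subn1 -subnDA.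
  by rewrite eqxx mul1r.
rewrite -val_eqE /= => j1; rewrite -!rmorphXn coefCM coef_map /= coefMC coefXn.
case: eqP => [|_]; last by rewrite mul0r.
by have := ltn_ord j; lia.
Qed.

End Residue.

(** * Morphisms, degrees and interpolation *)

Section MpolyMorphisms.
Variables (R : nzRingType) (n : nat).

Lemma rmorph_mmap (S T : nzRingType) (phi : {rmorphism S -> T}) (f : R -> S)
    (h : 'I_n -> S) (p : {mpoly R[n]}) :
  phi (mmap f h p) = mmap (phi \o f) (phi \o h) p.
Proof.
rewrite /mmap rmorph_sum; apply: eq_bigr => m _; rewrite rmorphM; congr (_ * _).
by rewrite /mmap1 rmorph_prod; apply: eq_bigr => i _; rewrite rmorphXn.
Qed.

Lemma eq_mmap (S : nzRingType) (f f' : R -> S) (h h' : 'I_n -> S) (p : {mpoly R[n]}) :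
  f =1 f' -> h =1 h' -> mmap f h p = mmap f' h' p.
Proof.
move=> ff' hh'; rewrite /mmap; apply: eq_bigr => m _; rewrite ff'; congr (_ * _).
exact: mmap1_eq.
Qed.

Lemma mmap_id (p : {mpoly R[n]}) : mmap (@mpolyC n R) (fun i => 'X_i) p = p.
Proof.
rewrite -[RHS]comp_mpoly_id; apply: eq_mmap => // i; by rewrite tnth_mktuple.
Qed.

End MpolyMorphisms.

Section PolyDegree.
Variable (K : nzRingType).
Implicit Types p q : {poly K}.

Lemma size_mul_bound a b p q :
  (size p <= a.+1)%N -> (size q <= b.+1)%N -> (size (p * q)%R <= (a + b).+1)%N.
Proof. by move=> pa qb; apply: leq_trans (size_polyMleq _ _) _; lia. Qed.

Lemma size_exp_bound a p m : (size p <= a.+1)%N -> (size (p ^+ m)%R <= (a * m).+1)%N.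
Proof.
move=> pa; elim: m => [|m IHm]; first by rewrite expr0 size_poly1.
by rewrite exprS mulnS; apply: size_mul_bound.
Qed.

Lemma size_sum_bound (I : Type) (s : seq I) (P : pred I) (f : I -> {poly K}) a :
  (forall i, P i -> size (f i) <= a)%N -> (size (\sum_(i <- s | P i) f i)%R <= a)%N.
Proof.
move=> fa; elim/big_rec: _ => [|i p Pi pa]; first by rewrite size_poly0.
by apply: leq_trans (size_polyD _ _) _; rewrite geq_max fa.
Qed.

Lemma size_add_bound a p q :
  (size p <= a)%N -> (size q <= a)%N -> (size (p + q)%R <= a)%N.
Proof. by move=> pa qa; apply: leq_trans (size_polyD _ _) _; rewrite geq_max pa. Qed.

Lemma size_mmap_bound (R : nzRingType) (n d : nat) (f : R -> K)
    (h : 'I_n -> {poly K}) (p : {mpoly R[n]}) D :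
  (forall i, size (h i) <= d.+1)%N -> (msize p <= D.+1)%N ->
  (size (mmap (polyC \o f) h p) <= (d * D).+1)%N.
Proof.
move=> hd pD; rewrite /mmap big_seq_cond; apply: size_sum_bound => m.
rewrite andbT => /msize_mdeg_lt mp; have mD : (mdeg m <= D)%N by lia.
apply: (@leq_trans (0 + d * mdeg m).+1); last by nia.
apply: size_mul_bound; first by rewrite size_polyC leq_b1.
rewrite /mmap1 mdegE; elim: (index_enum _) => [|i s IHs].
  by rewrite !big_nil size_poly1.
rewrite !big_cons mulnDr; apply: size_mul_bound => //; exact: size_exp_bound.
Qed.

End PolyDegree.

Section MpolyDegree.
Variables (F : fieldType) (k : nat).

Lemma msize_mul_bound a b (p q : {mpoly F[k]}) :
  (msize p <= a.+1)%N -> (msize q <= b.+1)%N -> (msize (p * q)%R <= (a + b).+1)%N.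
Proof.
move=> pa qb; have [->|p0] := eqVneq p 0; first by rewrite mul0r msize0.
have [->|q0] := eqVneq q 0; first by rewrite mulr0 msize0.
by rewrite msizeM //; move: (msize p) (msize q) pa qb => u v; lia.
Qed.

Lemma msizeC_le1 (c : F) : (msize (c%:MP : {mpoly F[k]}) <= 1)%N.
Proof. by rewrite msizeC leq_b1. Qed.

Lemma msize_add_bound a (p q : {mpoly F[k]}) :
  (msize p <= a)%N -> (msize q <= a)%N -> (msize (p + q)%R <= a)%N.
Proof. by move=> pa qa; apply: leq_trans (msizeD_le _ _) _; rewrite geq_max pa. Qed.

End MpolyDegree.

(** * Interpolation and nonvanishing in characteristic zero *)

Section CharZero.
Variable (F : fieldType).
Hypothesis char_F : [pchar F] =i pred0.

Lemma natr_inj_char0 (a b : nat) : a%:R = b%:R :> F -> a = b.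
Proof.
wlog ab : a b / (a <= b)%N => [W|].
  by case: (leqP a b) => [/W//|/ltnW/W ba /esym/ba].
move=> /eqP; rewrite -subr_eq0 -opprB oppr_eq0 -natrB // (pcharf0P _).1 // subn_eq0 => ba.
by apply/eqP; rewrite eqn_leq ab.
Qed.

(** The nodes 1, ..., [N] are distinct in characteristic zero, so their Vandermonde matrix is
    invertible over [F], and the same weights serve every ring [K] over [F]. The node 0 is avoided
    with a view to dividing by powers of the variable. *)
Lemma interpolation (K : nzRingType) (iota : {rmorphism F -> K}) N :
  exists gamma : 'I_N -> 'I_N -> F, forall p : {poly K}, (size p <= N)%N ->
    forall i : 'I_N, p`_i = \sum_(j < N) p.[j.+1%:R] * iota (gamma i j).
Proof.
pose a : 'rV[F]_N := \row_(j < N) j.+1%:R; pose V := Vandermonde N a.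
have VU : V \in unitmx.
  rewrite unitmxE det_Vandermonde unitfE; apply/prodf_neq0 => i _.
  apply/prodf_neq0 => j ij; rewrite !mxE subr_eq0.
  by apply: contraTneq ij => /natr_inj_char0 [->]; rewrite ltnn.
exists (fun i j => invmx V j i) => p pN i.
pose c : 'rV[K]_N := \row_k p`_k.
have pE (j : 'I_N) : p.[j.+1%:R] = (c *m map_mx iota V) 0 j.
  rewrite (horner_coef_wide _ pN) mxE; apply: eq_bigr => k _.
  by rewrite !mxE rmorphXn rmorph_nat.
transitivity ((c *m map_mx iota V *m map_mx iota (invmx V)) 0 i).
  by rewrite -mulmxA -map_mxM mulmxV // map_mx1 mulmx1 mxE.
by rewrite mxE; apply: eq_bigr => j _; rewrite pE [map_mx _ (invmx V) _ _]mxE.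
Qed.

Lemma poly_neq0_nonroot (p : {poly F}) : p != 0 -> exists t, p.[t] != 0.
Proof.
move=> p0; have [gamma pE] := interpolation idfun (size p).
have [/existsP [j pj]|] := boolP [exists j : 'I_(size p), p.[j.+1%:R] != 0].
  by exists j.+1%:R.
rewrite negb_exists => /forallP z; case/eqP: p0; apply/polyP => i; rewrite coef0.
have [iN|/(nth_default 0)] := ltnP i (size p); last by [].
rewrite (pE p (leqnn _) (Ordinal iN)) big1 // => j _.
by have := z j; rewrite negbK => /eqP ->; rewrite mul0r.
Qed.

Lemma mpoly_neq0_nonroot n (p : {mpoly F[n]}) : p != 0 -> exists x, p.@[x] != 0.
Proof.
elim: n p => [|n IHn] p p0.
  exists (fun=> 0); have pC : p = (p@_0)%:MP.
    apply: msize1_polyC; rewrite msizeE; apply/bigmax_leqP_seq => m _ _.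
    by rewrite mdegE big_ord0.
  by rewrite pC mevalC; apply: contra_neq p0; rewrite {2}pC => ->.
(* [h] reads [p] as a polynomial [q] in its last variable. Substituting back shows that [q] is
   nonzero, and a point where its leading coefficient does not vanish leaves a nonzero univariate
   polynomial. *)
pose h (i : 'I_n.+1) : {poly {mpoly F[n]}} :=
  if unlift ord_max i is Some j then ('X_j)%:P else 'X.
pose q := mmap (polyC \o @mpolyC n F) h p.
have q0 : q != 0.
  apply: contra_neq p0 => q0.
  pose iota := mmap (@mpolyC n.+1 F) (fun j : 'I_n => 'X_(lift ord_max j)).
  pose phi : {rmorphism {poly {mpoly F[n]}} -> {mpoly F[n.+1]}} :=
    @horner_eval _ ('X_ord_max : {mpoly F[n.+1]}) \o map_poly iota.
  have : phi q = 0 by rewrite q0 rmorph0.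
  rewrite /q rmorph_mmap => <-; rewrite -[LHS]mmap_id; apply: eq_mmap => [c|i] /=.
    by rewrite map_polyC horner_evalE hornerC /= mmapC.
  rewrite /h horner_evalE; case: unliftP => [j ->|->] /=.
    by rewrite map_polyC hornerC /= mmapX mmap1U.
  by rewrite map_polyX hornerX.
have [x qx] : exists x, (lead_coef q).@[x] != 0 by apply: IHn; rewrite lead_coef_eq0.
have [t qt] : exists t, (map_poly (meval x) q).[t] != 0.
  apply: poly_neq0_nonroot; apply: contraNneq qx => /(congr1 (coefp (size q).-1)).
  by rewrite /= coef_map coef0 => ->.
exists (fun i => if unlift ord_max i is Some j then x j else t).
apply: contra_neq qt => pt.
pose phi : {rmorphism {poly {mpoly F[n]}} -> F} :=
  @horner_eval _ t \o map_poly (meval x).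
rewrite -[LHS]/(phi q) /q rmorph_mmap -[RHS]pt; apply: eq_mmap => [c|i] /=.
  by rewrite map_polyC horner_evalE hornerC /= mevalC.
rewrite /h horner_evalE; case: unliftP => [j _|_] /=.
  by rewrite map_polyC hornerC /= mevalXU.
by rewrite map_polyX hornerX.
Qed.

End CharZero.

(** * Roots of polynomials computed by branching programs *)

Section BpRoots.
Variables (F : fieldType).
Hypothesis char_F : [pchar F] =i pred0.

Section BpCoefficients.
Variable n : nat.
Local Notation R := {mpoly F[n]}.

Lemma bp_computable_ord_sum N w (p : 'I_N -> R) :
  (forall i, bp_computable w (p i)) -> bp_computable (N * w) (\sum_i p i).
Proof.
move=> wp; have := bp_computable_sum (index_enum _) (w := fun=> w) (fun i (_ : true) => wp i).
by rewrite sum_nat_const card_ord.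
Qed.

Lemma bp_computable_coef N w (p : {poly R}) i : (size p <= N)%N ->
  (forall j, bp_computable w p.[j.+1%:R]) -> bp_computable (N * w) p`_i.
Proof.
move=> pN wp; have [gamma pE] := interpolation char_F (@mpolyC n F) N.
have [iN|iN] := ltnP i N; last first.
  by rewrite nth_default ?(leq_trans pN) //; apply: bp_computableW (bp_computable0 _ _).
rewrite (pE p pN (Ordinal iN)); apply: bp_computable_ord_sum => j.
by rewrite mulrC mul_mpolyC; apply: bp_computableZ.
Qed.

(** Interpolation in the outer variable over polynomials in the inner one, then in the inner
    variable. *)
Lemma bp_computable_coef2 N1 N2 w (p : {poly {poly R}}) i j : (size p <= N1)%N ->
  (forall a, (size p.[a.+1%:R] <= N2)%N) ->
  (forall a b, bp_computable w p.[a.+1%:R].[b.+1%:R]) ->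
  bp_computable (N1 * (N2 * w)) (p`_i)`_j.
Proof.
move=> pN1 pN2 wp.
have [gamma pE] := interpolation char_F (polyC \o @mpolyC n F) N1.
have [iN|iN] := ltnP i N1; last first.
  rewrite (nth_default _ (leq_trans pN1 iN)) coef0.
  exact: bp_computableW (bp_computable0 _ _).
rewrite (pE p pN1 (Ordinal iN)) coef_sum; apply: bp_computable_ord_sum => a.
rewrite coefMC mulrC mul_mpolyC; apply: bp_computableZ.
exact: bp_computable_coef.
Qed.

(** Integers are constants for the inner derivation, which therefore commutes with evaluating the
    outer variable at them. *)
Lemma horner_map_deriv (K : comNzRingType) (p : {poly {poly K}}) a :
  (map_poly (@deriv K) p).[a%:R] = p.[a%:R]^`().
Proof.
rewrite (horner_coef_wide (n := size p)); last exact: size_poly.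
rewrite horner_coef raddf_sum; apply: eq_bigr => i _.
rewrite coef_map /= derivM -[a%:R](rmorph_nat polyC) -rmorphXn derivC.
by rewrite mulr0 addr0.
Qed.

Lemma bp_computable_deriv N w (p : {poly R}) b : (size p <= N)%N ->
  (forall j, bp_computable w p.[j.+1%:R]) ->
  bp_computable (N * (N * w)) (p^`()).[b%:R].
Proof.
move=> pN wp.
have dN : (size p^`() <= N)%N by apply: leq_trans (size_poly _ _) _; lia.
rewrite (horner_coef_wide _ dN); apply: bp_computable_ord_sum => i.
have -> : p^`()`_i * b%:R ^+ i = ((i.+1 * b ^ i)%:R : F) *: p`_i.+1.
  rewrite -mul_mpolyC rmorph_nat natrM natrX -mulrA mulr_natl coef_deriv mulrnAl.
  by rewrite [_ * p`__]mulrC.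
exact/bp_computableZ/bp_computable_coef.
Qed.

End BpCoefficients.

(** [w1] is the cost of [A' * S] at one pair of nodes. The factors around it count the nodes in [v]
    and in [u] and the [M.+1] coefficients that are summed; the last 1 pays for the constant
    [t0]. *)
Definition root_bound (w D E : nat) : nat :=
  let M := (2 * E).+1 in
  let w1 := (D.+1 * (D.+1 * w) + M.+1 * (M * (1 + w) + 1))%N in
  (M.+1 * ((2 * D * M.+1).+1 * ((D * M.+1).+1 * w1)) + 1)%N.

(** As [d i] is constant, the forms stay affine in [x] when [u] and [v] are set to integers, so each
    value of the transformed [P] is computable in the size [w] of [r]; interpolation does the
    rest. *)
Lemma bp_computable_root n m w D E (r : {mpoly F[m]}) (l : 'I_m -> {mpoly F[n]})
    (d : 'I_m -> F) (g : {mpoly F[n]})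
    (P := mmap (polyC \o @mpolyC n F) (fun i => (l i)%:P + (d i)%:MP%:P * 'X) r) :
  (forall i, msize (l i) <= 2)%N -> bp_computable w r ->
  (msize r <= D.+1)%N -> (msize g <= E.+1)%N -> P != 0 -> root P g ->
  bp_computable (root_bound w D E) g.
Proof.
move=> aff_l wr rD gE P0 Pg.
have [e [q qg PE]] := multiplicity_XsubC P g; rewrite P0 /= in qg.
have e_gt0 : (0 < e)%N.
  by case: e PE => // PE; move: Pg; rewrite PE expr0 mulr1 (negbTE qg).
have eD : (e <= D)%N.
  have : (size P <= (1 * D).+1)%N.
    apply: size_mmap_bound rD => i; apply: size_add_bound.
      by rewrite size_polyC; apply: leq_trans (leq_b1 _) _.
    rewrite (@leq_trans (0 + 1).+1) // size_mul_bound ?size_polyX //.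
    by rewrite size_polyC leq_b1.
  have q0 : q != 0 by apply: contraNneq P0 => q0; rewrite PE q0 mul0r.
  rewrite PE size_Mmonic ?monic_exp ?monicXsubC // size_exp_XsubC.
  by have := q0; rewrite -size_poly_gt0; lia.
have [x0 qx0] : exists x, (q.[g]).@[x] != 0 by apply: mpoly_neq0_nonroot.
set c := q.[g].@[x0] in qx0; pose t0 := g.@[x0].
pose R := {mpoly F[n]}.
(* The line from [x0], at parameter 0, to the generic point, at parameter 1. With [u ^ 2] as
   parameter, [sig g - t0] is divisible by [u ^ 2]: one factor is absorbed by [t0 + u v], the other
   makes [y] divisible by [u]. *)
pose sig0 : {rmorphism R -> {poly R}} :=
  mmap (polyC \o @mpolyC n F) (fun j => (x0 j)%:MP%:P + ('X_j - (x0 j)%:MP)%:P * 'X).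
pose sig : {rmorphism R -> {poly R}} := @comp_poly R 'X^2 \o sig0.
have sigE p : sig p = mmap (polyC \o @mpolyC n F)
    (fun j => (x0 j)%:MP%:P + ('X_j - (x0 j)%:MP)%:P * 'X^2) p.
  rewrite [LHS]rmorph_mmap; apply: eq_mmap => [a|j] /=; first by rewrite comp_polyC.
  by rewrite comp_polyD comp_polyM !comp_polyC comp_polyX.
have sig_ev0 p : (sig p).[0] = (p.@[x0])%:MP.
  rewrite sigE -[LHS]/(horner_eval 0 _) -[RHS]/(mpolyC n _) !rmorph_mmap.
  apply: eq_mmap => [a|j] /=; first by rewrite horner_evalE hornerC.
  by rewrite horner_evalE !hornerE /= !mulr0 addr0.
have sig_ev1 p : (sig p).[1] = p.
  rewrite sigE -[LHS]/(horner_eval 1 _) rmorph_mmap -[RHS]mmap_id.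
  apply: eq_mmap => [a|j] /=; first by rewrite horner_evalE hornerC.
  by rewrite horner_evalE !hornerE /= !mulr1 addrC subrK.
have [y0 y0E] : exists y0, sig g = t0%:MP%:P + 'X * (y0 * 'X).
  have /factor_theorem [h hE] : root (sig0 g - t0%:MP%:P) 0.
    rewrite /root hornerD hornerN hornerC -[(sig0 g).[0]]/((sig0 g).[0]).
    have := sig_ev0 g; rewrite /= horner_comp hornerXn expr0n => ->.
    by rewrite subrr.
  exists (h \Po 'X^2); rewrite -[LHS]/(sig0 g \Po 'X^2) -[sig0 g](subrK t0%:MP%:P) hE.
  rewrite subr0 comp_polyD comp_polyC comp_polyM comp_polyX addrC; congr (_ + _).
  by rewrite mulrCA expr2.
clearbody sig.
pose V : {poly {poly R}} := 'X%:P.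
pose Y : {poly {poly R}} := map_poly polyC (y0 * 'X).
pose tau : {rmorphism R -> {poly {poly R}}} := map_poly polyC \o sig.
pose z : {poly {poly R}} := t0%:MP%:P%:P + 'X * V.
pose Th : {rmorphism {poly R} -> {poly {poly R}}} := @horner_eval _ z \o map_poly tau.
(* At [u = 0] the point is [x0] and [t] is [g(x0)], so the constant term in [u] is [c]; after
   division by [c] it is 1. *)
have Th_q0 : (Th q)`_0 = c%:MP%:P.
  pose ev0 : {rmorphism R -> {poly R}} := @horner_eval _ (0 : {poly R}) \o tau.
  have ev0E p : ev0 p = (p.@[x0])%:MP%:P.
    by rewrite /ev0 /tau /= horner_evalE -[0]/(polyC 0) horner_map /= sig_ev0.
  rewrite -horner_coef0; transitivity (map_poly ev0 q).[ev0 g]; last by rewrite horner_map ev0E.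
  have <- : z.[0] = ev0 g by rewrite ev0E /z hornerD hornerC hornerM hornerX mul0r addr0.
  rewrite -[LHS]/(horner_eval 0 (map_poly tau q).[z]) -horner_map -map_poly_comp.
  exact: erefl.
pose iota : {rmorphism F -> {poly R}} := polyC \o @mpolyC n F.
pose C : {poly {poly R}} := (iota c)%:P; pose Ci : {poly {poly R}} := (iota c^-1)%:P.
have iotaV x : x != 0 -> iota x * iota x^-1 = 1.
  by move=> x_neq0; rewrite -rmorphM mulfV // rmorph1.
have CCi : C * Ci = 1 by rewrite -rmorphM iotaV // rmorph1.
pose k := Ci * Th q.
have k0 : k`_0 = 1.
  by rewrite /k coefCM Th_q0 mulrC; apply: iotaV.
(* [sig g] has degree at most [2 * E] in [u], so the coefficients up to [M] determine [y]; the
   successor keeps [M] positive when [E = 0]. *)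
pose M := (2 * E).+1.
pose A := (V - Y) ^+ e * k.
pose Z := V ^+ e - A.
pose S := \sum_(i < M.+1) (V ^+ e) ^+ (M - i) * Z ^+ i.
have residue i : (i <= M)%N ->
    (map_poly (@deriv R) A * S)`_i`_(e * M.+1 - 2) = (y0 * 'X)`_i *+ e :=
  @log_deriv_residue R y0 k e M e_gt0 isT k0 i.
have ThP : Th P = C * 'X^e * A.
  rewrite PE rmorphM rmorphXn rmorphB /=.
  have -> : horner_eval z (map_poly tau 'X) - horner_eval z (map_poly tau g%:P) = 'X * (V - Y).
    rewrite map_polyX map_polyC !horner_evalE hornerX hornerC /=.
    rewrite y0E rmorphD /= map_polyC rmorphM /= map_polyX.
    by rewrite /z /Y mulrBr opprD addrACA subrr add0r.
  have AC (K : comNzRingType) (c1 x v c2 t : K) :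
    c1 * x * (v * (c2 * t)) = c1 * c2 * (t * (x * v)) by ring.
  by rewrite exprMn /A /k AC CCi mul1r.
have sigC a : sig a%:MP = a%:MP%:P by rewrite sigE mmapC.
have tauC a : tau a%:MP = a%:MP%:P%:P.
  rewrite /tau /= sigC map_polyC; reflexivity.
have ThC x : Th x%:P = tau x.
  rewrite -[LHS]/(map_poly tau x%:P).[z] map_polyC hornerC; reflexivity.
have ThX : Th 'X = z.
  rewrite -[LHS]/(map_poly tau 'X).[z] map_polyX hornerX; reflexivity.
have ThPE : Th P = mmap (polyC \o (polyC \o @mpolyC n F))
    (fun i => tau (l i) + (d i)%:MP%:P%:P * z) r.
  rewrite rmorph_mmap; apply: eq_mmap => [a|i].
    rewrite -[LHS]/(Th a%:MP%:P) ThC tauC; reflexivity.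
  rewrite -[LHS]/(Th ((l i)%:P + (d i)%:MP%:P * 'X)) rmorphD rmorphM !ThC ThX tauC.
  reflexivity.
set TP := Th P in ThP ThPE.
clearbody TP A.
have affine_at a : forall i, (msize (sig (l i)).[a%:R] <= 2)%N.
  move=> i; pose lin := [tuple (x0 j)%:MP + ('X_j - (x0 j)%:MP) * (a%:R ^+ 2)%:MP | j < n].
  have -> : (sig (l i)).[a%:R] = l i \mPo lin.
    rewrite sigE -[LHS]/(horner_eval _ _) rmorph_mmap; apply: eq_mmap => [b|j] /=.
      by rewrite horner_evalE hornerC.
    rewrite tnth_mktuple horner_evalE hornerD hornerM !hornerC hornerXn.
    by rewrite rmorphXn rmorph_nat.
  apply: msize_comp_affine => // j; rewrite tnth_mktuple.
  rewrite mulrC mul_mpolyC (leq_trans (msizeD_le _ _)) // geq_max msizeC.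
  rewrite (leq_trans (leq_b1 _)) //= (leq_trans (msizeZ_le _ _)) //.
  rewrite (leq_trans (msizeD_le _ _)) // geq_max msizeN msizeC msizeX mdeg1.
  by rewrite (leq_trans (leq_b1 _)).
have ThPaE a : TP.[a%:R] = mmap (polyC \o @mpolyC n F)
    (fun i => ((sig (l i)).[a%:R])%:P + (d i)%:MP%:P * (t0%:MP%:P + a%:R * 'X)) r.
  rewrite ThPE -[LHS]/(horner_eval _ _) rmorph_mmap; apply: eq_mmap => [b|i] /=.
    by rewrite horner_evalE hornerC.
  rewrite horner_evalE hornerD hornerM hornerC /z hornerD hornerC hornerM hornerX hornerC.
  congr (_ + _).
  by rewrite -[X in _.[X] = _](rmorph_nat polyC) horner_map.
have ThPabE a b : TP.[a%:R].[b%:R] =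
    r \mPo [tuple (sig (l i)).[a%:R] + (d i * (t0 + a%:R * b%:R))%:MP | i < m].
  rewrite ThPaE -[LHS]/(horner_eval _ _) rmorph_mmap; apply: eq_mmap => [b'|i] /=.
    by rewrite horner_evalE hornerC.
  rewrite tnth_mktuple horner_evalE hornerD hornerM !hornerC hornerD hornerC hornerM hornerX.
  by rewrite -[X in X.[b%:R] * _](rmorph_nat polyC) hornerC mpolyCM mpolyCD mpolyCM !rmorph_nat.
have bpThP a b : bp_computable w TP.[a%:R].[b%:R].
  rewrite ThPabE; apply: bp_computable_comp => // i; rewrite tnth_mktuple.
  rewrite (leq_trans (msizeD_le _ _)) // geq_max affine_at msizeC.
  exact: leq_trans (leq_b1 _) _.
(* At the nonzero node [a.+1] the division by [c * u ^ e] is a mere scaling. *)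
have AaE a : A.[a.+1%:R] = iota (c * a.+1%:R ^+ e)^-1 * TP.[a.+1%:R].
  have a0 : a.+1%:R != 0 :> F by rewrite (pcharf0P _).1.
  rewrite ThP !hornerM hornerC hornerXn -[X in _ * X ^+ e * _](rmorph_nat iota).
  have <- : iota (c * a.+1%:R ^+ e) = iota c * iota a.+1%:R ^+ e by rewrite rmorphM rmorphXn.
  rewrite mulrA [iota _^-1 * _]mulrC iotaV; last by rewrite mulf_neq0 ?expf_neq0.
  by rewrite mul1r.
have size_ThP : (size TP <= (2 * D).+1)%N.
  rewrite ThPE; apply: size_mmap_bound rD => i; apply: size_add_bound.
    rewrite /tau /= size_map_inj_poly ?polyC0 //; last exact: polyC_inj.
    rewrite sigE -[3%N]/((2 * 1).+1).
    apply: size_mmap_bound (aff_l i) => j; apply: size_add_bound.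
      by rewrite size_polyC (leq_trans (leq_b1 _)).
    apply: (size_mul_bound (a := 0)); last by rewrite size_polyXn.
    by rewrite size_polyC leq_b1.
  apply: (size_mul_bound (a := 0)); first by rewrite size_polyC leq_b1.
  apply: size_add_bound; first by rewrite size_polyC (leq_trans (leq_b1 _)).
  apply: (size_mul_bound (a := 1) (b := 1)); first by rewrite size_polyX.
  by rewrite size_polyC (leq_trans (leq_b1 _)).
have size_A : (size A <= (2 * D).+1)%N.
  have [-> | A0] := eqVneq A 0; first by rewrite size_poly0.
  have cMP : iota c != 0 by rewrite /iota /= polyC_eq0 mpolyC_eq0.
  move: size_ThP; rewrite ThP -mulrA size_Cmul // mulrC size_mulXn //.
  by apply: leq_trans; rewrite leq_addl.
have size_Aa a : (size A.[a.+1%:R] <= D.+1)%N.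
  rewrite AaE; apply: (size_mul_bound (a := 0)); first by rewrite size_polyC leq_b1.
  rewrite ThPaE -[D]mul1n; apply: size_mmap_bound rD => i; apply: size_add_bound.
    by rewrite size_polyC (leq_trans (leq_b1 _)).
  apply: (size_mul_bound (a := 0)); first by rewrite size_polyC leq_b1.
  apply: size_add_bound; first by rewrite size_polyC (leq_trans (leq_b1 _)).
  apply: (size_mul_bound (a := 0) (b := 1)); last by rewrite size_polyX.
  by rewrite -(rmorph_nat polyC) size_polyC leq_b1.
have bpA a b : bp_computable w A.[a.+1%:R].[b.+1%:R].
  by rewrite AaE hornerM hornerC mul_mpolyC; apply: bp_computableZ.
pose B := map_poly (@deriv R) A * S.
have BaE a : B.[a%:R] = (A.[a%:R])^`() *
    \sum_(i < M.+1) ('X^e) ^+ (M - i) * ('X^e - A.[a%:R]) ^+ i.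
  rewrite hornerM horner_map_deriv horner_sum; congr (_ * _); apply: eq_bigr => i _.
  by rewrite hornerM !horner_exp hornerD hornerN horner_exp hornerC.
have size_B : (size B <= (2 * D * M.+1).+1)%N.
  rewrite mulnS; apply: size_mul_bound; first exact: leq_trans (size_poly _ _) _.
  apply: size_sum_bound => i _; rewrite (@leq_trans (0 + 2 * D * i).+1) //; last first.
    by have := ltn_ord i; nia.
  apply: size_mul_bound; first by rewrite -!rmorphXn size_polyC leq_b1.
  apply: size_exp_bound; apply: size_add_bound; last by rewrite size_polyN.
  by rewrite -rmorphXn size_polyC (leq_trans (leq_b1 _)).
have size_Ba a : (size B.[a.+1%:R] <= (D * M.+1).+1)%N.
  rewrite BaE mulnS; apply: size_mul_bound.
    by apply: leq_trans (size_poly _ _) _; have := size_Aa a; lia.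
  apply: size_sum_bound => i _; rewrite (@leq_trans (D * (M - i) + D * i).+1) //; last first.
    by have := ltn_ord i; nia.
  apply: size_mul_bound; apply: size_exp_bound; first by rewrite size_polyXn.
  by apply: size_add_bound; rewrite ?size_polyN // size_polyXn.
have bpB a b : bp_computable (D.+1 * (D.+1 * w) + M.+1 * (M * (1 + w) + 1)) B.[a.+1%:R].[b.+1%:R].
  rewrite BaE hornerM -[(_ + M.+1 * _)%N]/(D.+1 * (D.+1 * w) + _)%N.
  apply: bp_computableM; first exact: bp_computable_deriv.
  rewrite horner_sum; apply: bp_computable_ord_sum => i.
  rewrite hornerM !horner_exp hornerD hornerN !horner_exp !hornerX.
  (* At a node [V ^+ e] is a constant, so its powers only scale. *)
  have -> : b.+1%:R ^+ e = (b.+1%:R ^+ e)%:MP :> R by rewrite rmorphXn rmorph_nat.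
  rewrite -[_%:MP ^+ (M - i)](rmorphXn (@mpolyC n F)) mul_mpolyC.
  apply: bp_computableZ; apply: bp_computableW (bp_computableX _ (w := 1 + w) _).
    by have := ltn_ord i; rewrite leq_add2r leq_mul2r => ?; apply/orP; right; lia.
  rewrite -scaleN1r.
  by apply: bp_computableD; [apply: bp_computableC | apply: bp_computableZ].
have size_y : (size (y0 * 'X)%R <= M.+1)%N.
  have : (size ('X * (y0 * 'X))%R <= (2 * E).+1)%N.
    have -> : 'X * (y0 * 'X) = sig g - t0%:MP%:P by rewrite y0E addrC addKr.
    apply: size_add_bound; last first.
      by rewrite size_polyN size_polyC (leq_trans (leq_b1 _)).
    rewrite sigE; apply: size_mmap_bound gE => j; apply: size_add_bound.
      by rewrite size_polyC (leq_trans (leq_b1 _)).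
    apply: (size_mul_bound (a := 0)); last by rewrite size_polyXn.
    by rewrite size_polyC leq_b1.
  have [-> | y_neq0] := eqVneq (y0 * 'X) 0; first by rewrite size_poly0.
  move: y_neq0; move: (y0 * 'X) => y y_neq0; rewrite mulrC size_mulX // => ltE.
  exact: leq_trans (leqnSn _) (leq_trans ltE (leqnSn _)).
have e0 : e%:R != 0 :> F by rewrite (pcharf0P _).1 // -lt0n.
(* At [u = 1] the substitution [sig] is the identity, so [g - t0] is the sum of the coefficients of
   [y], each a residue divided by [e]. *)
have -> : g = e%:R^-1 *: (\sum_(i < M.+1) (B`_i)`_(e * M.+1 - 2)) + t0%:MP.
  rewrite -[LHS]sig_ev1 y0E hornerD hornerC hornerM hornerX mul1r addrC; congr (_ + _).
  rewrite (horner_coef_wide _ size_y) scaler_sumr; apply: eq_bigr => i _.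
  have iM : (i <= M)%N by rewrite -ltnS ltn_ord.
  transitivity (e%:R^-1 *: ((y0 * 'X)`_i *+ e)); last exact: congr1 _ (esym (residue i iM)).
  by rewrite -scaler_nat scalerA mulVf // scale1r expr1n mulr1.
apply: bp_computableD; last exact: bp_computableC.
apply: bp_computableZ; apply: bp_computable_ord_sum => i.
exact: bp_computable_coef2.
Qed.

End BpRoots.

(** * Straight-line programs and circuits *)

Section StraightLinePrograms.
Variables (F : fieldType) (k : nat).
Local Notation R := {mpoly F[k]}.
Implicit Types (ps : seq R) (a b : R).

(** An operand is named by its value, not by its position, so programs can be extended without
    renumbering; [slp_operand_node] recovers positions. *)
Definition slp_operand ps a : Prop :=
  [\/ a \in ps, exists i, a = 'X_i | exists c, a = c%:MP].

Inductive slp : seq R -> Prop :=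
| slp_nil : slp [::]
| slp_rcons ps o a b : slp ps -> slp_operand ps a -> slp_operand ps b ->
    slp (rcons ps (ring_op o a b)).

Lemma slp_operand_rcons ps c a : slp_operand ps a -> slp_operand (rcons ps c) a.
Proof.
by case=> [aps|ai|ac]; [apply: Or31; rewrite mem_rcons inE aps orbT | apply: Or32 | apply: Or33].
Qed.

Lemma slp_operand_last ps c : slp_operand (rcons ps c) c.
Proof. by apply: Or31; rewrite mem_rcons mem_head. Qed.

Lemma slp_gate ps : slp ps -> forall i, (i < size ps)%N ->
  exists o a b, [/\ ps`_i = ring_op o a b, slp_operand (take i ps) a
                  & slp_operand (take i ps) b].
Proof.
elim=> {ps} [|ps o a b _ IHps opa opb] i //; rewrite size_rcons ltnS leq_eqVlt.
case/predU1P=> [->|lt_i].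
  by exists o, a, b; rewrite nth_rcons ltnn eqxx -cats1 take_size_cat.
have [o' [a' [b' [iE opa' opb']]]] := IHps i lt_i.
by exists o', a', b'; rewrite nth_rcons lt_i -cats1 takel_cat // ltnW.
Qed.

Lemma slp_operand_node ps i s a : size ps = s -> slp_operand (take i ps) a ->
  exists u : node F k s, (forall j, u = Gate j -> (j < i)%N) /\
    node_eval (fun j => 'X_j) (fun c => c%:MP) (fun j : 'I_s => ps`_j) u = a.
Proof.
move=> sz [/(nthP 0) [j]|[j ->]|[c ->]]; [|by exists (InVar j)|by exists (InConst c)].
rewrite size_take_min leq_min => /andP [ji js]; rewrite nth_take // => <-.
rewrite sz in js; exists (Gate (Ordinal js)); split=> // j' [<-]; exact: ji.
Qed.

Lemma slp_circuit ps a : slp (rcons ps a) ->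
  exists C : circuit F k (size ps).+1, circuit_poly C = a.
Proof.
set s := (size ps).+1 => slp_ps; set qs := rcons ps a in slp_ps.
have sz : size qs = s by rewrite size_rcons.
have gates (i : 'I_s) : exists g : gate_op * (node F k s * node F k s),
    [/\ forall j, g.2.1 = Gate j -> (j < i)%N, forall j, g.2.2 = Gate j -> (j < i)%N
      & ring_op g.1
          (node_eval (fun j => 'X_j) (fun c => c%:MP) (fun j : 'I_s => qs`_j) g.2.1)
          (node_eval (fun j => 'X_j) (fun c => c%:MP) (fun j : 'I_s => qs`_j) g.2.2) = qs`_i].
  have [|o [b [c [-> opb opc]]]] := slp_gate slp_ps (i := i); first by rewrite sz.
  have [u [ltu <-]] := slp_operand_node sz opb.
  by have [v [ltv <-]] := slp_operand_node sz opc; exists (o, (u, v)).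
have {gates} /fin_all_exists [g gP] := gates.
have lt_l i j : (g i).2.1 = Gate j -> (j < i)%N by have [] := gP i => + _ _; apply.
have lt_r i j : (g i).2.2 = Gate j -> (j < i)%N by have [] := gP i => _ + _; apply.
pose C := @Circuit F k s (fun i => (g i).1) (fun i => (g i).2.1) (fun i => (g i).2.2)
  (Gate ord_max) lt_l lt_r erefl.
exists C.
have evalE d (i : 'I_s) : (i < d)%N ->
    gate_eval 0 (fun j => 'X_j) (fun c => c%:MP) (@ring_op R) C d i = qs`_i.
  elim: d i => // d IHd i; rewrite ltnS => le_id /=.
  have [_ _ <-] := gP i; congr ring_op.
    case gE: (g i).2.1 => [j|c|j] //=; apply: IHd.
    exact: leq_trans (lt_l _ _ gE) le_id.
  case gE: (g i).2.2 => [j|c|j] //=; apply: IHd.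
  exact: leq_trans (lt_r _ _ gE) le_id.
by rewrite -[LHS]/(gate_eval _ _ _ _ _ _ _) evalE // /qs nth_rcons ltnn eqxx.
Qed.

End StraightLinePrograms.

(** * Circuit evaluation with perturbed gates *)

Section PerturbedEvaluation.
Variables (F : fieldType) (n s : nat) (C : circuit F n s).

Section Eval.
Variables (T : nzRingType) (var : 'I_n -> T) (const : F -> T) (noise : 'I_s -> T).

(* Inverts the triangular part of the local encoding: gate values in which
   [noise i] is the prescribed value of the [i]-th gate equation. *)
Fixpoint perturbed_gate (d : nat) (i : 'I_s) : T :=
  if d is d'.+1 then
    let L := node_eval var const (perturbed_gate d') in
    noise i + ring_op (gop C i) (L (gleft C i)) (L (gright C i))
  else 0.

Definition perturbed_node : node F n s -> T :=
  node_eval var const (perturbed_gate s).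

(** A gate refers only to gates of smaller index, so the triangular system has one solution and any
    fuel beyond the index reaches it. *)
Lemma perturbed_gate_unique (G : 'I_s -> T) :
  (forall i, G i = noise i + ring_op (gop C i) (node_eval var const G (gleft C i))
                                               (node_eval var const G (gright C i))) ->
  forall d (i : 'I_s), (i < d)%N -> perturbed_gate d i = G i.
Proof.
move=> GE; elim=> // d IHd i; rewrite ltnS => le_id; rewrite GE /=; congr (_ + ring_op _ _ _).
  case gE: (gleft C i) => [j|c|j] //=; apply: IHd.
  exact: leq_trans (gleft_lt gE) le_id.
case gE: (gright C i) => [j|c|j] //=; apply: IHd.
exact: leq_trans (gright_lt gE) le_id.
Qed.

Lemma perturbed_gateE i : perturbed_gate s i =
  noise i + ring_op (gop C i) (perturbed_node (gleft C i)) (perturbed_node (gright C i)).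
Proof.
have fuel d (j : 'I_s) : (j < d)%N -> perturbed_gate d.+1 j = perturbed_gate d j.
  elim: d j => // d IHd j; rewrite ltnS => le_jd.
  rewrite [LHS]/= [RHS]/=; congr (_ + ring_op _ _ _).
    case gE: (gleft C j) => [l|c|l] //=; apply: IHd.
    exact: leq_trans (gleft_lt gE) le_jd.
  case gE: (gright C j) => [l|c|l] //=; apply: IHd.
  exact: leq_trans (gright_lt gE) le_jd.
by rewrite -fuel.
Qed.

End Eval.

Lemma rmorph_perturbed (T U : nzRingType) (phi : {rmorphism T -> U}) var const noise u :
  phi (perturbed_node var const noise u) =
  perturbed_node (phi \o var) (phi \o const) (phi \o noise) u.
Proof.
suff gateE d i : phi (perturbed_gate var const noise d i) =
    perturbed_gate (phi \o var) (phi \o const) (phi \o noise) d i.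
  by rewrite /perturbed_node; case: u => //= i; apply: gateE.
elim: d i => [|d IHd] i /=; first exact: rmorph0.
rewrite rmorphD; congr (_ + _).
by case: (gop C i); rewrite /= ?(rmorphD, rmorphM);
  case: (gleft C i) => *; case: (gright C i) => *; rewrite /= ?IHd.
Qed.

Lemma circuit_poly_perturbed :
  circuit_poly C =
  perturbed_node (fun i => 'X_i) (fun c => c%:MP) (fun=> 0) (output C).
Proof.
suff gateE d i : gate_eval 0 (fun i => 'X_i) (fun c => c%:MP) (@ring_op _) C d i =
    perturbed_gate (fun i => 'X_i) (fun c => c%:MP) (fun=> 0) d i :> {mpoly F[n]}.
  by rewrite /circuit_poly /circuit_eval /perturbed_node; case: (output C) => //= i.
elim: d i => //= d IHd i; rewrite add0r.
by case: (gleft C i) => *; case: (gright C i) => *; rewrite /= ?IHd.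
Qed.

End PerturbedEvaluation.

(** * Refutations of the local encoding *)

Section LocalEncoding.
Variables (F : fieldType) (n s : nat) (C : circuit F n s) (alpha : 'I_n -> F) (beta : F).
Local Notation G := (local_encoding C alpha beta).

Lemma local_encoding_input i :
  tnth G (lshift 1 (lshift s i)) = 'X_(lshift s i) - (alpha i)%:MP.
Proof. by rewrite !tnth_lshift tnth_mktuple. Qed.

Lemma local_encoding_gate i : tnth G (lshift 1 (rshift n i)) =
  'X_(rshift n i) - ring_op (gop C i) (encoding_L (gleft C i)) (encoding_L (gright C i)).
Proof. by rewrite tnth_lshift tnth_rshift tnth_mktuple. Qed.

Lemma local_encoding_output i :
  tnth G (rshift (n + s) i) = encoding_L (output C) - beta%:MP.
Proof. by rewrite tnth_rshift ord1. Qed.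

Section Solution.
Variables (T : comNzRingType) (iota : {rmorphism F -> T}) (a : 'I_(n + s) -> T).

Lemma mmap_encoding_L u : mmap iota a (encoding_L u) =
  node_eval (fun i => a (lshift s i)) iota (fun i => a (rshift n i)) u.
Proof. by case: u => [i|c|i]; rewrite /= ?mmapX ?mmap1U ?mmapC. Qed.

(** At any point [a], not only at a zero, the values of the first [n + s] equations determine the
    node values: they are read as input shifts and gate noise of a perturbed evaluation. *)
Lemma local_encoding_solution u :
  mmap iota a (encoding_L u) = perturbed_node C
    (fun i => mmap iota a (tnth G (lshift 1 (lshift s i))) + iota (alpha i)) iota
    (fun i => mmap iota a (tnth G (lshift 1 (rshift n i)))) u.
Proof.
have inputE i : mmap iota a (tnth G (lshift 1 (lshift s i))) + iota (alpha i) =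
    a (lshift s i).
  by rewrite local_encoding_input rmorphB /= mmapC mmapX mmap1U subrK.
have nodeE g v : node_eval
      (fun i => mmap iota a (tnth G (lshift 1 (lshift s i))) + iota (alpha i)) iota g v =
    node_eval (fun i => a (lshift s i)) iota g v.
  by case: v => [i|c|i] //=.
rewrite mmap_encoding_L /perturbed_node nodeE; case: u => //= i.
symmetry; apply: (perturbed_gate_unique (G := fun i => a (rshift n i))) => // {}i.
rewrite !nodeE local_encoding_gate rmorphB /= mmapX mmap1U -!mmap_encoding_L.
by case: (gop C i); rewrite /= ?(rmorphD, rmorphM) subrK.
Qed.

End Solution.

Local Notation m := (n + s + 1)%N.

Definition refutation_output (u : node F n s) : {mpoly F[m]} :=
  perturbed_node C (fun i => 'X_(lshift 1 (lshift s i)) + (alpha i)%:MP)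
    (fun c => c%:MP) (fun i => 'X_(lshift 1 (rshift n i))) u.

Definition refutation : {mpoly F[m]} :=
  ((beta - (circuit_poly C).@[alpha])^-1)%:MP *
  ('X_(rshift (n + s) ord0) + beta%:MP - refutation_output (output C)).

Lemma eq_perturbed_node (T : nzRingType) var var' const const' noise noise' u :
  var =1 var' -> const =1 const' -> noise =1 noise' ->
  @perturbed_node F n s C T var const noise u = perturbed_node C var' const' noise' u.
Proof.
move=> varE constE noiseE.
suff gateE d i : perturbed_gate C var const noise d i =
    perturbed_gate C var' const' noise' d i.
  by rewrite /perturbed_node; case: u => [i|c|i] /=.
elim: d i => //= d IHd i; rewrite noiseE.
by case: (gleft C i) => *; case: (gright C i) => *;
  rewrite /= ?varE ?constE ?IHd.
Qed.

(** After substitution of the equations, both [z_out + beta] and the perturbed output become the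
    label of the output node, by [local_encoding_solution] at the generic point. *)
Lemma refutation_comp : refutation \mPo G = 0.
Proof.
rewrite rmorphM rmorphB rmorphD /= !comp_mpolyC.
apply/eqP; rewrite mulf_eq0; apply/orP; right; apply/eqP.
rewrite [_ \mPo _](mmapX _ (@mpolyC _ F)) mmap1U local_encoding_output subrK.
rewrite (rmorph_perturbed C (comp_mpoly G)).
have := local_encoding_solution (@mpolyC (n + s) F) (fun i => 'X_i) (output C).
rewrite mmap_id => ->; apply/eqP; rewrite subr_eq0; apply/eqP.
apply: eq_perturbed_node => [i|c|i] /=.
- by rewrite rmorphD /= comp_mpolyC [_ \mPo _](mmapX _ (@mpolyC _ F)) mmap1U mmap_id.
- by rewrite comp_mpolyC.
- by rewrite [RHS](mmapX _ (@mpolyC _ F)) mmap1U mmap_id.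
Qed.

Lemma meval_circuit_poly : (circuit_poly C).@[alpha] =
  perturbed_node C alpha idfun (fun=> 0) (output C).
Proof.
rewrite circuit_poly_perturbed (rmorph_perturbed C (meval alpha)).
by apply: eq_perturbed_node => [i|c|i] /=; rewrite ?mevalXU ?mevalC ?meval0.
Qed.

Hypothesis neq_beta : (circuit_poly C).@[alpha] <> beta.

Lemma refutation_at0 : refutation.@[fun=> 0] = 1.
Proof.
rewrite rmorphM rmorphB rmorphD /= !mevalC mevalXU add0r.
rewrite (rmorph_perturbed C (meval (fun=> 0))) meval_circuit_poly.
rewrite (eq_perturbed_node (var' := alpha) (const' := idfun) (noise' := fun=> 0)).
- rewrite mulVf // subr_eq0 -meval_circuit_poly eq_sym; exact/eqP.
- by move=> i /=; rewrite rmorphD /= mevalXU mevalC add0r.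
- by move=> c /=; rewrite mevalC.
- by move=> i /=; rewrite mevalXU.
Qed.

Lemma local_encoding_refuted : geometric_IPS_refutation G refutation.
Proof. by split; [apply: refutation_comp | apply: refutation_at0]. Qed.

(** At a common zero the identity [r(G) = 0] would read [r(0) = 0], against [r(0) = 1]. *)
Lemma local_encoding_unsat : unsatisfiable G.
Proof.
move=> K iota _ [a aG0].
have := congr1 (mmap iota a) refutation_comp.
rewrite [comp_mpoly _ _]/(mmap _ _ _) rmorph_mmap rmorph0.
rewrite (eq_mmap (f' := iota \o @meval m F (fun=> 0) \o @mpolyC m F)
  (h' := iota \o @meval m F (fun=> 0) \o (fun i => 'X_i)) refutation).
- rewrite -(rmorph_mmap (iota \o @meval m F (fun=> 0))) mmap_id /= refutation_at0.
  by move/eqP; rewrite rmorph1 oner_eq0.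
- by move=> c /=; rewrite mmapC mevalC.
- by move=> i /=; rewrite aG0 mevalXU rmorph0.
Qed.

Lemma msize_refutation : (msize refutation <= (formal_degree C).+1)%N.
Proof.
pose fd : nat -> 'I_s -> nat := gate_eval 0%N (fun=> 1%N) (fun=> 1%N)
  (fun o a b => match o with Add => maxn a b | Mul => (a + b)%N end) C.
pose vx (i : 'I_n) : {mpoly F[m]} := 'X_(lshift 1 (lshift s i)) + (alpha i)%:MP.
pose vc (c : F) : {mpoly F[m]} := c%:MP.
pose vy (i : 'I_s) : {mpoly F[m]} := 'X_(lshift 1 (rshift n i)).
pose fdL d : node F n s -> nat := node_eval (fun=> 1%N) (fun=> 1%N) (fd d).
have varX k (i : 'I_k) a : (msize ('X_i + a%:MP : {mpoly F[k]}) <= 2)%N.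
  apply: msize_add_bound; first by rewrite msizeX mdeg1.
  exact: leq_trans (msizeC_le1 _ _) _.
(* Positivity of the formal degree is carried along to absorb the noise variable, of degree 1, added
   at each gate. *)
have gateP d (i : 'I_s) : (i < d)%N -> (0 < fd d i)%N /\
  (msize (perturbed_gate C vx vc vy d i) <= (fd d i).+1)%N.
  elim: d i => // d IHd i; rewrite ltnS => le_id.
  have nodeP u : (forall j, u = Gate j -> (j < i)%N) ->
      (0 < fdL d u)%N /\
      (msize (node_eval vx vc (perturbed_gate C vx vc vy d) u) <= (fdL d u).+1)%N.
    case: u => [j|c|j] ltu /=; split=> //.
    - exact: varX.
    - exact: leq_trans (msizeC_le1 _ _) _.
    - by have [] := IHd j (leq_trans (ltu j erefl) le_id).
    - by have [] := IHd j (leq_trans (ltu j erefl) le_id).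
  have [l0 ll] := nodeP _ (@gleft_lt F n s C i).
  have [r0 rr] := nodeP _ (@gright_lt F n s C i).
  have X2 : (msize (vy i) <= 2)%N by rewrite msizeX mdeg1.
  have -> : fd d.+1 i = match gop C i with
      | Add => maxn (fdL d (gleft C i)) (fdL d (gright C i))
      | Mul => (fdL d (gleft C i) + fdL d (gright C i))%N end by [].
  split; first by case: (gop C i); rewrite /= ?leq_max ?l0 // ltn_addr.
  rewrite [perturbed_gate _ _ _ _ _ _]/=; apply: msize_add_bound.
    by apply: leq_trans X2 _; case: (gop C i); rewrite /= ltnS ?leq_max ?l0 // ltn_addr.
  case: (gop C i) => /=; last exact: msize_mul_bound.
  by apply: msize_add_bound; [apply: leq_trans ll _ | apply: leq_trans rr _];
    rewrite ltnS leq_max leqnn ?orbT.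
have [fd0 out] : (0 < formal_degree C)%N /\
    (msize (refutation_output (output C)) <= (formal_degree C).+1)%N.
  rewrite /formal_degree /circuit_eval /refutation_output /perturbed_node.
  case: (output C) => [i|c|i] /=; [split=> // | split=> // | exact: gateP].
  exact: leq_trans (msizeC_le1 _ _) _.
rewrite /refutation mul_mpolyC; apply: leq_trans (msizeZ_le _ _) _; apply: msize_add_bound.
  by apply: leq_trans (varX _ _ _) _.
by rewrite msizeN.
Qed.

(** One addition per input, two operations per gate (its own and the added noise), three to form the
    difference, and the scaling as final gate. *)
Lemma slp_refutation : exists ps, slp (rcons ps refutation) /\
  (size ps <= n + 2 * s + 3)%N.
Proof.
pose x (i : 'I_n) : {mpoly F[m]} := 'X_(lshift 1 (lshift s i)) + (alpha i)%:MP.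
have inputs d : (d <= n)%N -> exists ps, [/\ slp ps, (size ps <= d)%N
    & forall i : 'I_n, (i < d)%N -> slp_operand ps (x i)].
  elim: d => [|d IHd] dn; first by exists [::]; split=> //; apply: slp_nil.
  have [ps [slp_ps sz xs]] := IHd (ltnW dn).
  exists (rcons ps (x (Ordinal dn))); split.
  - by apply: (slp_rcons Add slp_ps); [apply: Or32; eexists | apply: Or33; eexists].
  - by rewrite size_rcons.
  move=> i; rewrite ltnS leq_eqVlt => /predU1P [iE|/xs]; last exact: slp_operand_rcons.
  have -> : i = Ordinal dn by exact: val_inj.
  exact: slp_operand_last.
have gates d : (d <= s)%N -> exists ps, [/\ slp ps, (size ps <= n + 2 * d)%N,
    forall i : 'I_n, slp_operand ps (x i)
    & forall i : 'I_s, (i < d)%N -> slp_operand ps (refutation_output (Gate i))].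
  elim: d => [|d IHd] ds.
    have [ps [slp_ps sz xs]] := inputs n (leqnn n).
    by exists ps; split=> //; rewrite ?addn0 // => i; apply: xs.
  have [ps [slp_ps sz xs gs]] := IHd (ltnW ds); pose i := Ordinal ds.
  have operand u : (forall j, u = Gate j -> (j < i)%N) ->
      slp_operand ps (refutation_output u).
    case: u => [j|c|j] ltu; [exact: xs | by apply: Or33; exists c | exact/gs/ltu].
  have opl := operand _ (@gleft_lt F n s C i).
  have opr := operand _ (@gright_lt F n s C i).
  pose g := ring_op (gop C i) (refutation_output (gleft C i)) (refutation_output (gright C i)).
  have gE : refutation_output (Gate i) = 'X_(lshift 1 (rshift n i)) + g.
    exact: perturbed_gateE.
  exists (rcons (rcons ps g) (refutation_output (Gate i))); split.
  - rewrite gE; apply: (slp_rcons Add); first exact: slp_rcons.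
      by apply: Or32; eexists.
    exact: slp_operand_last.
  - by rewrite !size_rcons; lia.
  - by move=> j; apply/slp_operand_rcons/slp_operand_rcons/xs.
  move=> j; rewrite ltnS leq_eqVlt => /predU1P [jE|/gs]; last first.
    by move=> opj; apply/slp_operand_rcons/slp_operand_rcons.
  have -> : j = i by exact: val_inj.
  exact: slp_operand_last.
have [ps [slp_ps sz xs gs]] := gates s (leqnn s).
have op_out : slp_operand ps (refutation_output (output C)).
  by case: (output C) => [j|c|j]; [exact: xs | apply: Or33; exists c | exact: gs].
pose q1 := (-1)%:MP * refutation_output (output C).
pose q2 := 'X_(rshift (n + s) ord0) + q1; pose q3 := beta%:MP + q2.
exists (rcons (rcons (rcons ps q1) q2) q3); split; last by rewrite !size_rcons; lia.
have -> : refutation = ((beta - (circuit_poly C).@[alpha])^-1)%:MP * q3.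
  by rewrite /refutation /q3 /q2 /q1 mpolyCN mulN1r [beta%:MP + _]addrCA addrA.
have op_const qs c : slp_operand qs (c%:MP : {mpoly F[m]}) by apply: Or33; exists c.
apply: (slp_rcons Mul) (op_const _ _) (slp_operand_last _ _).
apply: (slp_rcons Add) (op_const _ _) (slp_operand_last _ _).
apply: (slp_rcons Add) _ (slp_operand_last _ _); last by apply: Or32; eexists.
exact: (slp_rcons Mul).
Qed.

Lemma refutation_circuit : exists (t : nat) (D : circuit F m t),
  (t <= n + 2 * s + 4)%N /\ circuit_poly D = refutation.
Proof.
have [ps [slp_ps sz]] := slp_refutation; have [D DE] := slp_circuit slp_ps.
by exists (size ps).+1, D; split=> //; lia.
Qed.

(** An input or output equation is one addition of a constant; a gate equation takes the gate
    operation, a negation and a sum. *)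
Lemma local_encoding_circuit i : exists (t : nat) (D : circuit F (n + s) t),
  (t <= 3)%N /\ circuit_poly D = tnth G i.
Proof.
have op_const qs c : slp_operand qs (c%:MP : {mpoly F[n + s]}) by apply: Or33; exists c.
have op_L qs u : slp_operand qs (encoding_L u : {mpoly F[n + s]}).
  by case: u => [j|c|j] //=; apply: Or32; eexists.
suff [ps [slp_ps sz]] : exists ps, slp (rcons ps (tnth G i)) /\ (size ps <= 2)%N.
  by have [D DE] := slp_circuit slp_ps; exists (size ps).+1, D.
case: (split_ordP i) => [{}i ->|{}i ->]; last first.
  exists [::]; split=> //; rewrite local_encoding_output -mpolyCN.
  by apply: (slp_rcons Add) (op_L _ _) (op_const _ _); apply: slp_nil.
case: (split_ordP i) => [{}i ->|{}i ->].
  exists [::]; split=> //; rewrite local_encoding_input -mpolyCN.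
  apply: (slp_rcons Add) (op_const _ _); first exact: slp_nil.
  by apply: Or32; eexists.
pose q := ring_op (gop C i) (encoding_L (gleft C i)) (encoding_L (gright C i)).
exists [:: q; (-1)%:MP * q]; split=> //; rewrite local_encoding_gate -/q.
have -> : - q = (-1)%:MP * q by rewrite mpolyCN mulN1r.
apply: (slp_rcons (ps := [:: q; _]) Add).
- apply: (slp_rcons (ps := [:: q]) Mul) (op_const _ _) (slp_operand_last [::] _).
  exact (slp_rcons (gop C i) (slp_nil F (n + s)) (op_L _ (gleft C i)) (op_L _ (gright C i))).
- by apply: Or32; eexists.
- exact: (slp_operand_last [:: q]).
Qed.

End LocalEncoding.

(** * Polynomially bounded functions *)

Section PolynomialGrowth.
Implicit Types t u : nat -> nat.

Lemma leq_expn2r a b c : (a <= b)%N -> (a ^ c <= b ^ c)%N.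
Proof. by case: c => [|c] ab; rewrite ?expn0 // leq_exp2r. Qed.

(** The base [n.+2], at least 2, absorbs the additive constant and makes closure under sums and
    products easy. *)
Lemma poly_boundedP t : poly_bounded t <-> exists c, forall n, (t n <= n.+2 ^ c)%N.
Proof.
split=> [[c tc]|[c tc]].
  exists c.+1 => n; apply: leq_trans (tc n) _.
  have nc : (n ^ c <= n.+2 ^ c)%N by apply: leq_expn2r; lia.
  have cc : (c <= n.+2 ^ c)%N by apply: ltnW; apply: ltn_expl.
  by rewrite expnS; nia.
(* For [n <= 1] the constant is at least [3 ^ c]; for [n >= 2], [n.+2 <= n ^ 2] doubles the
   exponent. *)
exists (2 * c + 3 ^ c)%N => n; apply: leq_trans (tc n) _.
have [n_le1|n_gt1] := leqP n 1.
  by apply: leq_trans (_ : 3 ^ c <= _)%N; [apply: leq_expn2r | lia].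
apply: leq_trans (_ : n ^ (2 * c) <= _)%N.
  by rewrite expnM; apply: leq_expn2r; nia.
by rewrite -[X in (X <= _)%N]addn0 leq_add // leq_exp2l // leq_addr.
Qed.

Lemma poly_boundedW t u : (forall n, t n <= u n)%N -> poly_bounded u -> poly_bounded t.
Proof. by move=> tu [c uc]; exists c => n; apply: leq_trans (tu n) (uc n). Qed.

Lemma poly_boundedD t u :
  poly_bounded t -> poly_bounded u -> poly_bounded (fun n => t n + u n)%N.
Proof.
move=> /poly_boundedP [c tc] /poly_boundedP [d ud]; apply/poly_boundedP.
exists (maxn c d).+1 => n; rewrite expnS.
have := leq_trans (tc n) (leq_pexp2l (ltn0Sn _) (leq_maxl c d)).
have := leq_trans (ud n) (leq_pexp2l (ltn0Sn _) (leq_maxr c d)).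
by nia.
Qed.

Lemma poly_boundedM t u :
  poly_bounded t -> poly_bounded u -> poly_bounded (fun n => t n * u n)%N.
Proof.
move=> /poly_boundedP [c tc] /poly_boundedP [d ud]; apply/poly_boundedP.
by exists (c + d)%N => n; rewrite expnD leq_mul.
Qed.

Lemma poly_boundedC c : poly_bounded (fun=> c).
Proof. by exists c => n; rewrite leq_addl. Qed.

Lemma poly_bounded_id : poly_bounded id.
Proof. by exists 1%N => n; rewrite expn1 leq_addr. Qed.

Lemma poly_bounded_lt_expn t :
  poly_bounded t -> exists c N, forall n, (N <= n)%N -> (t n < n ^ c)%N.
Proof.
move=> [c tc]; exists c.+1, c.+2 => n n_ge; apply: leq_ltn_trans (tc n) _.
have n1 : (1 <= n ^ c)%N by rewrite expn_gt0; lia.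
by rewrite expnS; nia.
Qed.

Lemma poly_bounded_root_bound (w D E : nat -> nat) :
  poly_bounded w -> poly_bounded D -> poly_bounded E ->
  poly_bounded (fun n => root_bound (w n) (D n) (E n)).
Proof.
move=> wP DP EP; rewrite /root_bound.
do ?[assumption | apply: poly_boundedC
  | match goal with
    | |- poly_bounded (fun n => (@?a n).+1) => apply: (poly_boundedD (poly_boundedC 1) (u := a))
    | |- poly_bounded (fun n => (_ + _)%N) => apply: poly_boundedD
    | |- poly_bounded (fun n => (_ * _)%N) => apply: poly_boundedM
    end].
Qed.

End PolynomialGrowth.

(** * Lower bound *)

Lemma abp_of_refutation (F : fieldType) (char_F : [pchar F] =i pred0) (n s : nat)
    (C : circuit F n s) (alpha : 'I_n -> F) (beta : F)
    (r : {mpoly F[n + s + 1]}) (w : nat) (B : abp F (n + s + 1) w) :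
  geometric_IPS_refutation (local_encoding C alpha beta) r -> abp_poly B = r ->
  exists (w' : nat) (B' : abp F n w'),
    (w' <= (root_bound w (msize r).-1 (msize (circuit_poly C)).-1 + 1).+1 ^ 2 + 2)%N /\
    abp_poly B' = circuit_poly C.
Proof.
move=> [rG r0] BE; set f := circuit_poly C.
(* The values of the equations along a correct computation on [x], with the value of the output
   equation left free as [t]; [d i] is the coefficient of [t]. *)
pose l (i : 'I_(n + s + 1)) : {mpoly F[n]} :=
  if split i is inl i' then
    if split i' is inl j then 'X_j - (alpha j)%:MP else 0
  else 0.
pose d (i : 'I_(n + s + 1)) : F := if split i is inl _ then 0 else 1.
pose g : {mpoly F[n]} := f - beta%:MP.
pose P := mmap (polyC \o @mpolyC n F) (fun i => (l i)%:P + (d i)%:MP%:P * 'X) r.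
have lP i : [/\ l (lshift 1 (lshift s i)) = 'X_i - (alpha i)%:MP
              & d (lshift 1 (lshift s i)) = 0].
  by rewrite /l /d (unsplitK (inl _)) (unsplitK (inl _)).
have lG i : [/\ l (lshift 1 (rshift n i)) = 0 & d (lshift 1 (rshift n i)) = 0].
  by rewrite /l /d (unsplitK (inl _)) (unsplitK (inr _)).
have lO i : [/\ l (rshift (n + s) i) = 0 & d (rshift (n + s) i) = 1].
  by rewrite /l /d (unsplitK (inr _)).
have aff_l i : (msize (l i) <= 2)%N.
  rewrite /l; case: split => [i'|_]; last by rewrite msize0.
  case: split => [j|_]; last by rewrite msize0.
  apply: msize_add_bound; first by rewrite msizeX mdeg1.
  by rewrite msizeN; apply: leq_trans (msizeC_le1 _ _) _.
(* At [x = alpha], [t = 0] all arguments of [r] vanish, so [P] takes the value [r(0) = 1]. *)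
have P0 : P != 0.
  pose ev : {rmorphism {poly {mpoly F[n]}} -> F} :=
    @meval n F alpha \o @horner_eval _ (0 : {mpoly F[n]}).
  apply/eqP => /(congr1 ev); rewrite rmorph0 /P rmorph_mmap.
  rewrite (eq_mmap (f' := idfun) (h' := fun=> 0)) => [|c|i] /=.
  - by rewrite -/(meval _ r) r0 => /eqP; rewrite oner_eq0.
  - by rewrite horner_evalE hornerC mevalC.
  rewrite horner_evalE hornerD hornerM !hornerC hornerX mulr0 addr0.
  case: (split_ordP i) => [i' ->|i' ->]; last by have [-> _] := lO i'; rewrite meval0.
  case: (split_ordP i') => [j ->|j ->]; last by have [-> _] := lG j; rewrite meval0.
  by have [-> _] := lP j; rewrite rmorphB /= mevalXU mevalC subrr.
have Pg : root P g.
  (* [psi] fills in the true gate values: the gate equations vanish and the output equation becomes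
     [g], so [P(x, g)] is the image of [r(G) = 0]. *)
  pose psi : {rmorphism {mpoly F[n + s]} -> {mpoly F[n]}} :=
    mmap (@mpolyC n F) (fun i => match split i with
      | inl j => 'X_j
      | inr j => perturbed_gate C (fun i => 'X_i) (fun c => c%:MP) (fun=> 0) s j end).
  have psiL u : psi (encoding_L u) =
      perturbed_node C (fun i => 'X_i) (fun c => c%:MP) (fun=> 0) u.
    rewrite [LHS]mmap_encoding_L; case: u => [i|c|i] //=.
      by rewrite (unsplitK (inl _)).
    by rewrite (unsplitK (inr _)).
  have : psi (r \mPo local_encoding C alpha beta) = 0 by rewrite rG rmorph0.
  rewrite [_ \mPo _]/(mmap _ _ _) rmorph_mmap => psi0.
  rewrite /root -[P.[g]]/(horner_eval g P) /P rmorph_mmap -psi0; apply/eqP.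
  apply: eq_mmap => [c|i] /=.
    by rewrite horner_evalE hornerC mmapC.
  rewrite horner_evalE hornerD hornerM !hornerC hornerX -/psi.
  case: (split_ordP i) => [i' ->|i' ->]; last first.
    have [-> ->] := lO i'; rewrite add0r mpolyC1 mul1r local_encoding_output.
    by rewrite rmorphB psiL /= mmapC -circuit_poly_perturbed.
  case: (split_ordP i') => [j ->|j ->].
    have [-> ->] := lP j; rewrite mpolyC0 mul0r addr0 local_encoding_input.
    by rewrite rmorphB /= mmapC mmapX mmap1U (unsplitK (inl _)).
  have [-> ->] := lG j; rewrite mpolyC0 mul0r addr0 local_encoding_gate.
  rewrite rmorphB; have -> : psi 'X_(rshift n j) = psi (ring_op (gop C j)
      (encoding_L (gleft C j)) (encoding_L (gright C j))).
    rewrite [LHS]mmapX mmap1U (unsplitK (inr _)) perturbed_gateE add0r -!psiL.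
    by case: (gop C j); rewrite /= ?rmorphD ?rmorphM.
  by rewrite subrr.
have bp_r : bp_computable w r by rewrite -BE; apply: bp_computable_abp.
have rD : (msize r <= (msize r).-1.+1)%N by exact: leqSpred.
have gE : (msize g <= (msize f).-1.+1)%N.
  apply: msize_add_bound; first exact: leqSpred.
  by rewrite msizeN; apply: leq_trans (msizeC_le1 _ _) _.
have bp_g := bp_computable_root char_F aff_l bp_r rD gE P0 Pg.
have bp_f : bp_computable (root_bound w (msize r).-1 (msize f).-1 + 1) f.
  rewrite -[X in bp_computable _ X](subrK beta%:MP); apply: bp_computableD bp_g _.
  exact: bp_computableC.
exact: abp_of_bp_computable bp_f.
Qed.

(** Circuits are data, but their existence is known only for each [n] separately; classical choice
    assembles them into a sequence. *)
Lemma circuit_sequence (F : fieldType) (k b : nat -> nat) (f : mpoly_seq F k) :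
  (forall n, exists (t : nat) (D : circuit F (k n) t),
    (t <= b n)%N /\ circuit_poly D = f n) ->
  exists (t : nat -> nat) (D : forall n, circuit F (k n) (t n)),
    (forall n, t n <= b n)%N /\ forall n, circuit_poly (D n) = f n.
Proof.
move=> fD.
have small n : exists tD : {t : nat & circuit F (k n) t},
    (projT1 tD <= b n)%N /\ circuit_poly (projT2 tD) = f n.
  by have [t [D [tb DE]]] := fD n; exists (existT _ t D).
pose tD n := proj1_sig (ClassicalEpsilon.constructive_indefinite_description _ (small n)).
have tDP n : (projT1 (tD n) <= b n)%N /\ circuit_poly (projT2 (tD n)) = f n.
  exact: proj2_sig (ClassicalEpsilon.constructive_indefinite_description _ (small n)).
exists (fun n => projT1 (tD n)), (fun n => projT2 (tD n)).
by split=> n; have [] := tDP n.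
Qed.

Theorem theorem5p4 (F : fieldType) (char_F : [pchar F] =i pred0)
  (f : forall n : nat, {mpoly F[n]})
  (f_VP : @VP F (fun n => n) f)
  (f_hard : @requires_superpoly_abp F (fun n => n) f)
  (s : nat -> nat) (Phi : forall n : nat, circuit F n (s n))
  (s_poly : poly_bounded s)
  (Phi_computes : forall n : nat, circuit_poly (Phi n) = f n)
  (alpha : forall n : nat, 'I_n -> F) (beta : nat -> F)
  (f_neq : forall n : nat, (f n).@[alpha n] <> beta n) :
  let G : system_seq F (fun n => n + s n)%N (fun n => n + s n + 1)%N :=
    fun n => local_encoding (Phi n) (alpha n) (beta n) in
  [/\ forall n : nat, unsatisfiable (G n),
      family_of_equations (@VNC0 F) G,
      poly_bounded (fun n => formal_degree (Phi n)) ->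
        refuted_by_geometric_IPS (@VP F) G
    & ~ refuted_by_geometric_IPS (@VBP F) G].
Proof.
move=> G.
have neq_beta n : (circuit_poly (Phi n)).@[alpha n] <> beta n.
  by rewrite Phi_computes.
split.
- by move=> n; apply: local_encoding_unsat.
- move=> i deg_i; split=> //.
  have [t [D [t3 DE]]] := circuit_sequence (b := fun=> 3%N)
    (fun n => local_encoding_circuit (Phi n) (alpha n) (beta n) (i n)).
  by exists t, D; split=> //; exists 3%N.
- move=> fd_poly; exists (fun n => refutation (Phi n) (alpha n) (beta n)).
  split; last by move=> n; apply: local_encoding_refuted.
  split.
    apply: poly_boundedW fd_poly => n.
    by have := msize_refutation (Phi n) (alpha n) (beta n); lia.
  have [t [D [t_le DE]]] := circuit_sequence
    (fun n => refutation_circuit (Phi n) (alpha n) (beta n)).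
  exists t, D; split=> //; apply: poly_boundedW t_le _.
  apply: poly_boundedD (poly_boundedC 4).
  apply: poly_boundedD poly_bounded_id _.
  exact: poly_boundedM (poly_boundedC 2) s_poly.
move=> [r [[deg_r [w [B [w_poly BE]]]] rP]].
pose bound n := ((root_bound (w n) (msize (r n)).-1 (msize (f n)).-1 + 1).+1 ^ 2 + 2)%N.
have bound_poly : poly_bounded bound.
  apply: poly_boundedD (poly_boundedC 2).
  suff root_poly : poly_bounded
      (fun n => (root_bound (w n) (msize (r n)).-1 (msize (f n)).-1 + 1).+1).
    exact (poly_boundedM root_poly root_poly).
  apply: (poly_boundedD (poly_boundedC 1)).
  apply: poly_boundedD (poly_boundedC 1).
  by apply: poly_bounded_root_bound => //; have [] := f_VP.
(* The polynomial bound is eventually below [n ^ c], whereas hardness gives at least [n ^ c]; one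
   [n] beyond both thresholds gives the contradiction. *)
have [c [N lt_bound]] := poly_bounded_lt_expn bound_poly.
have [N' hard] := f_hard c; pose n := maxn N N'.
have [w' [B' [le_w' B'E]]] := abp_of_refutation char_F (rP n) (BE n).
rewrite Phi_computes in le_w' B'E.
have := hard n (leq_maxr _ _) w' B' B'E.
by rewrite leqNgt (leq_ltn_trans le_w') // lt_bound // leq_maxl.
Qed.
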